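(* For every $\alpha>0$ there is a constant $C=C(\alpha)$ such that the following holds. If $D_0$ is an $n$-vertex digraph on vertex set $[n]$ with minimum semi-degree $\delta^0(D_0)\ge \alpha n$, then asymptotically almost surely (i.e., with probability tending to $1$ as $n\to\infty$) the digraph $D_0\cup D(n,C/n)$ contains every orientation of a cycle of every length between $2$ and $n$ (simultaneously).
   Context: A digraph is a loop-free set of vertices with a set of ordered pairs of distinct vertices (edges); between two vertices there is at most one edge in each direction. The minimum semi-degree $\delta^0(D)$ is the minimum over all vertices of all in- and outdegrees. $D(n,p)$ is the random digraph on $[n]$ in which each of the $n(n-1)$ possible directed edges is present independently with probability $p$; $D_0\cup D(n,p)$ is the digraph on $[n]$ whose edge set is the union of the two edge sets. An orientation of a cycle of length $\ell\ge 3$ is a digraph obtained from the undirected cycle on $\ell$ vertices by replacing each edge $uv$ by exactly one of the directed edges $uv$ or $vu$; a cycle of length $2$ consists of two vertices $u,v$ with both edges $uv$ and $vu$. ''Contains'' means contains a subdigraph isomorphic to it. *)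

(* Defs.v *)
From HB Require Import structures.
From mathcomp Require Import all_boot all_order all_algebra.
From mathcomp Require Import reals.
Set Implicit Arguments.
Unset Strict Implicit.
Unset Printing Implicit Defensive.
Import Order.TTheory GRing.Theory Num.Theory.
Local Open Scope ring_scope.

(* A digraph with vertex set T is given by its edge set D : {set T * T},      *)
(* subject to [loopless D]; (x, y) \in D is the edge directed from x to y.    *)
Definition loopless (T : finType) (D : {set T * T}) : bool :=
  [forall x, (x, x) \notin D].

Definition outdegree (T : finType) (D : {set T * T}) (x : T) : nat :=
  #|[set y | (x, y) \in D]|.

Definition indegree (T : finType) (D : {set T * T}) (x : T) : nat :=
  #|[set y | (y, x) \in D]|.

(* The default value #|T| exceeds every degree of a loopless digraph, so it   *)
(* only matters when T is empty.                                              *)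
Definition min_semidegree (T : finType) (D : {set T * T}) : nat :=
  \big[minn/#|T|]_(x : T) minn (outdegree D x) (indegree D x).

(* D contains a (not necessarily induced) subdigraph isomorphic to H.         *)
Definition contains (S T : finType) (D : {set T * T}) (H : {set S * S}) : bool :=
  [exists f : {ffun S -> T},
    injectiveb f && [forall e in H, (f e.1, f e.2) \in D]].

Definition is_orientation (S : finType) (g : rel S) (H : {set S * S}) : bool :=
  [forall x, forall y,
    if g x y then ((x, y) \in H) (+) ((y, x) \in H) else (x, y) \notin H].

(* The undirected cycle 0, 1, ..., l - 1, 0 (a simple graph for 3 <= l);      *)
(* [ordS] is the successor modulo l.                                          *)
Definition cycle_adj (l : nat) : rel 'I_l :=
  fun x y => (y == ordS x) || (x == ordS y).

(* H is an oriented cycle of length l on the vertex set 'I_l. Length 2 is     *)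
(* special: both directed edges are present.                                  *)
Definition oriented_cycle (l : nat) (H : {set 'I_l * 'I_l}) : bool :=
  if l == 2%N then H == [set e | e.1 != e.2]
  else (3 <= l)%N && is_orientation (@cycle_adj l) H.

Definition contains_all_oriented_cycles (n : nat) (D : {set 'I_n * 'I_n}) :
    bool :=
  [forall l : 'I_n.+1, (2 <= l)%N ==>
    [forall H : {set 'I_l * 'I_l}, oriented_cycle H ==> contains D H]].

(* The probability that D(n, p) satisfies A. It is a probability only when    *)
(* 0 <= p <= 1.                                                               *)
Definition random_digraph_prob (R : realType) (n : nat) (p : R)
    (A : pred {set 'I_n * 'I_n}) : R :=
  \sum_(E : {set 'I_n * 'I_n} | loopless E && A E)
    \prod_(e : 'I_n * 'I_n | e.1 != e.2) (if e \in E then p else 1 - p).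

(* Main.v *)
(* With p = C/n and C large, a union bound over the 4^n pairs of vertex sets
   shows that with high probability the random edges go from A to B whenever A
   and B are disjoint of size at least e, for a small linear e. Together with
   the minimum semi-degree of D0 this alone yields every oriented cycle of
   length at least 3; 2-cycles come from a random edge reversing an edge of D0.

   Short cycles are built greedily. A long one is assembled from an absorber, a
   long path found by depth-first search, and pieces covering a few leftover
   vertices. The absorber is a path with single-vertex gaps, grouped in gadgets.
   A gadget has a main gap (x, y) filled by any vertex of a linear set W, and,
   for each vertex v of a bounded list S, a gap filled either by v or by a
   vertex d of W which is otherwise put in the main gap. Hence it absorbs any
   one vertex of W or of S. The gaps (x, y) and the flexible set L are sampled
   so that every vertex of L lies in linearly many W and every W meets L in a
   linear set, while a sparse random choice of the lists S joins any linear set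
   of gadgets to any linear subset of L. So once some vertices of L have been
   spent on covering the leftover, the remaining ones can always be matched
   perfectly with the gadgets. *)

Require Import Defs.
From HB Require Import structures.
From mathcomp Require Import all_boot all_order all_algebra all_fingroup.
From mathcomp Require Import reals.
From mathcomp Require Import zify ring lra.
Set Implicit Arguments.
Unset Strict Implicit.
Unset Printing Implicit Defensive.
Import Order.TTheory GRing.Theory Num.Theory.
Local Open Scope nat_scope.


(** * Greedy choices, sampling and matchings *)

(** This is (1 - 1/c)^c <= 1/2. It follows from Bernoulli's inequality (1 + 1/x)^k >= 1 + k/x with x
    = c - 1 and k = c. *)
Lemma expn_pred_half c : 0 < c -> 2 * c.-1 ^ c <= c ^ c.
Proof.
case: c => // x _ /=.
have H k : (x + k) * x ^ k <= x.+1 ^ k * x.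
  elim: k => [|k IH]; first by rewrite !expn0; lia.
  rewrite !expnS; have := leq_mul (leqnn x.+1) IH; nia.
case: x H => [|x] H; first by rewrite exp0n.
have := H x.+2; nia.
Qed.

(** Disjoint blocks are chosen one at a time, [F] being the set of elements already used. It never
    holds more than [size js - 1] blocks, whence the bound on [#|F|]. *)
Lemma greedy_blocks (T : finType) (J : eqType) (c : nat) (P : J -> seq T -> Prop)
    (js : seq J) :
  uniq js ->
  (forall j (F : {set T}), j \in js -> #|F| + c <= c * size js ->
     exists s, [/\ size s = c, uniq s, {in s, forall x, x \notin F} & P j s]) ->
  exists S : J -> seq T,
    {in js, forall j, size (S j) = c /\ P j (S j)} /\
    uniq (flatten [seq S j | j <- js]).
Proof.
elim: js => [|j js IH] /=; first by move=> _ _; exists (fun=> [::]).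
case/andP=> jNjs Ujs H.
have [|S [S1 S2]] := IH Ujs.
  by move=> i F iS hF; apply: H; [rewrite inE iS orbT | rewrite mulnS; lia].
have szS : size (flatten [seq S i | i <- js]) = c * size js.
  rewrite size_flatten /shape -map_comp.
  elim: (js) S1 => [|i l IHl] hS /=; first by rewrite muln0.
  rewrite IHl; last by move=> u ul; apply: hS; rewrite inE ul orbT.
  by case: (hS i (mem_head _ _)) => -> _; rewrite mulnS.
have [||s [s1 s2 s3 s4]] := H j [set x in flatten [seq S i | i <- js]].
- exact: mem_head.
- by rewrite mulnS addnC leq_add2l -szS cardsE card_size.
exists (fun i => if i == j then s else S i).
have E : [seq (if i == j then s else S i) | i <- js] = [seq S i | i <- js].
  by apply/eq_in_map => i iS; case: eqP => // eij; rewrite -eij iS in jNjs.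
rewrite eqxx E; split.
- move=> i; rewrite inE; case: (i =P j) => [-> //|_] /= iS; exact: S1.
- rewrite cat_uniq s2 S2 andbT /=; apply/hasPn => x xS; apply/negP => /s3.
  by rewrite !inE xS.
Qed.

(* Conditional expectations: each choice keeps the potential sum_i 2^(-hits of i)
   shrinking by the factor 1 - 1/(2c). *)
Lemma weighted_sampling (O I : finType) (Inv : pred (seq O))
    (hit : nat -> I -> pred O) (c N h : nat) (i0 : I) (o0 : O) :
  0 < c ->
  Inv [::] ->
  (forall s, Inv s -> size s < N -> forall i,
     #|O| <= c * #|[set a | Inv (rcons s a) && hit (size s) i a]|) ->
  4 * c * h <= N -> #|I| < 2 ^ h ->
  exists s, [/\ size s = N, Inv s &
    forall i, h <= count (fun p => hit p.1 i p.2) (zip (iota 0 N) s)].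
Proof.
move=> c0 Inv0 H hN hI.
pose hits s i := count (fun p => hit p.1 i p.2) (zip (iota 0 (size s)) s).
have hits_le s i : hits s i <= size s.
  by apply: leq_trans (count_size _ _) _; rewrite size_zip size_iota minnn.
have hits_rcons s a i : hits (rcons s a) i = hits s i + hit (size s) i a.
  rewrite /hits size_rcons -addn1 iotaD add0n /= cats1 zip_rcons ?size_iota //.
  by rewrite -cats1 count_cat /= addn0.
pose Psi s := \sum_i 2 ^ (N - hits s i).
have step k : k <= N -> exists s, [/\ size s = k, Inv s &
    (2 * c) ^ k * Psi s <= (2 * c).-1 ^ k * (#|I| * 2 ^ N)].
  elim: k => [_|k IH kN].
    exists [::]; split=> //; rewrite !expn0 !mul1n /Psi.
    under eq_bigr do rewrite /hits /= subn0.
    by rewrite sum_nat_const.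
  have [s [s1 s2 s3]] := IH (ltnW kN).
  have kN' : size s < N by rewrite s1.
  (* Averaging: each i is hit by at least |O|/c of the choices and at most |O| choices are
     admissible, so some admissible [a] hits at least a 1/c fraction of the potential. *)
  have [a Ia Ha] : exists2 a, Inv (rcons s a) &
      Psi s <= c * \sum_i hit (size s) i a * 2 ^ (N - hits s i).
    apply/exists_inP; apply: contraT; rewrite negb_exists => /forallP Hn.
    pose A := [set a | Inv (rcons s a)].
    have A0 : 0 < #|A|.
      have := H s s2 kN' i0; rewrite lt0n; case: eqP => // /eqP; rewrite cards_eq0.
      move=> /eqP A0; have : 0 < #|O| by apply/card_gt0P; exists o0.
      have -> : [set a | Inv (rcons s a) && hit (size s) i0 a] = set0.
        apply/setP => a; rewrite !inE.
        by have /setP /(_ a) := A0; rewrite !inE => ->.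
      by rewrite cards0; lia.
    have L : \sum_(a in A) Psi s > \sum_(a in A) c * \sum_i hit (size s) i a * 2 ^ (N - hits s i).
      have [a aA] : exists a, a \in A by apply/card_gt0P.
      rewrite (bigD1 a) //= [X in _ < X](bigD1 a) //=.
      have lt b : b \in A -> c * \sum_i hit (size s) i b * 2 ^ (N - hits s i) < Psi s.
        by rewrite inE => Ib; have := Hn b; rewrite Ib /= -ltnNge.
      have := lt a aA.
      have : \sum_(i in A | i != a) c * \sum_i0 hit (size s) i0 i * 2 ^ (N - hits s i0)
         <= \sum_(i in A | i != a) Psi s.
        by apply: leq_sum => b /andP [bA _]; apply/ltnW/lt.
      lia.
    move: L; rewrite sum_nat_const -big_distrr exchange_big /= ltnNge => /negP [].
    apply: (@leq_trans (\sum_i #|O| * 2 ^ (N - hits s i))).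
      rewrite -big_distrr /= leq_mul2r max_card orbT //.
    rewrite big_distrr; apply: leq_sum => i _ /=.
    rewrite -big_distrl /= mulnA leq_mul2r; apply/orP; right.
    apply: leq_trans (H s s2 kN' i) _; rewrite leq_mul2l; apply/orP; right.
    rewrite -sum1_card big_mkcond [X in _ <= X]big_mkcond /=.
    by apply: leq_sum => b _; rewrite !inE; case: (Inv _); case: (hit _ _ _).
  exists (rcons s a); split=> //; first by rewrite size_rcons s1.
  (* A hit halves the term of i, so the potential drops by half of the weight that [a] hits. *)
  have E : Psi s = Psi (rcons s a) + \sum_i hit (size s) i a * 2 ^ (N - hits (rcons s a) i).
    rewrite /Psi -big_split /=; apply: eq_bigr => i _; rewrite hits_rcons.
    case: (hit _ _ _); last by rewrite /= addn0 mul0n addn0.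
    have -> : N - hits s i = (N - (hits s i + 1)).+1 by have := hits_le s i; lia.
    by rewrite /= expnS; lia.
  have E2 : \sum_i hit (size s) i a * 2 ^ (N - hits s i) =
            2 * \sum_i hit (size s) i a * 2 ^ (N - hits (rcons s a) i).
    rewrite big_distrr; apply: eq_bigr => i _ /=; rewrite hits_rcons.
    case: (hit _ _ _); last by rewrite /= !mul0n muln0.
    have -> : N - hits s i = (N - (hits s i + 1)).+1 by have := hits_le s i; lia.
    by rewrite /= expnS; lia.
  have E3 : 2 * c * Psi (rcons s a) <= (2 * c).-1 * Psi s.
    move: Ha; rewrite E2 E; set X := \sum_i _; set Y := Psi _ => Ha.
    have -> : (2 * c).-1 = 2 * c - 1 by lia.
    rewrite mulnBl; nia.
  rewrite !expnS; set u := (2 * c) ^ k in s3 *; set v := (2 * c).-1 ^ k in s3 *.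
  have -> : 2 * c * u * Psi (rcons s a) = u * (2 * c * Psi (rcons s a)) by lia.
  apply: leq_trans (leq_mul (leqnn u) E3) _.
  have -> : u * ((2 * c).-1 * Psi s) = (2 * c).-1 * (u * Psi s) by lia.
  have -> : (2 * c).-1 * v * (#|I| * 2 ^ N) = (2 * c).-1 * (v * (#|I| * 2 ^ N)) by lia.
  by rewrite leq_mul2l s3 orbT.
have [s [s1 s2 s3]] := step N (leqnn N).
exists s; split=> // i; rewrite leqNgt; apply/negP => hlt.
have {}hlt : hits s i < h by rewrite /hits s1.
have P1 : 2 ^ (N - hits s i) <= Psi s by rewrite /Psi (bigD1 i) //= leq_addr.
have hN' : h <= N by nia.
(* An index with fewer than h hits alone keeps the potential above 2^(N - h). The upper bound [s3]
   contradicts this, since (1 - 1/(2c))^N <= 2^(-2h) and |I| < 2^h. *)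
have P2 : 2 ^ N < 2 ^ h * Psi s.
  apply: leq_trans (leq_mul (leqnn (2 ^ h)) P1).
  by rewrite -expnD ltn_exp2l //; have := hits_le s i; lia.
have P3 : (2 * c).-1 ^ N * 2 ^ (2 * h) <= (2 * c) ^ N.
  have C2 : 2 ^ (2 * h) * (2 * c).-1 ^ (2 * c * (2 * h)) <= (2 * c) ^ (2 * c * (2 * h)).
    have H2 : 2 * (2 * c).-1 ^ (2 * c) <= (2 * c) ^ (2 * c) by apply: expn_pred_half; lia.
    rewrite [2 * c * _]mulnC mulnC. rewrite [(2 * h) * _]mulnC !(expnM _ (2 * c)).
    rewrite -expnMn; case: (posnP h) => [->|h0]; first by rewrite muln0 !expn0.
    by rewrite leq_exp2r ?muln_gt0 // mulnC.
  have -> : N = 2 * c * (2 * h) + (N - 4 * c * h) by lia.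
  have uv : (2 * c).-1 ^ (N - 4 * c * h) <= (2 * c) ^ (N - 4 * c * h).
    by case: (posnP (N - 4 * c * h)) => [->//|p0]; rewrite leq_exp2r // leq_pred.
  rewrite !(expnD _ (2 * c * (2 * h))); apply: leq_trans (leq_mul C2 uv).
  by rewrite [2 ^ (2 * h) * _]mulnC mulnAC.
have c1 : 0 < (2 * c).-1 ^ N by rewrite expn_gt0; apply/orP; left; lia.
have : (2 * c) ^ N * Psi s < (2 * c) ^ N * Psi s; last by rewrite ltnn.
apply: leq_ltn_trans s3 _.
apply: (@leq_trans ((2 * c).-1 ^ N * 2 ^ (2 * h) * Psi s)); last first.
  by rewrite leq_mul2r P3 orbT.
rewrite -!mulnA ltn_pmul2l // mul2n -addnn expnD -mulnA.
apply: (@leq_ltn_trans (2 ^ h * 2 ^ N)); first by rewrite leq_mul2r ltnW ?hI // orbT.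
by rewrite ltn_pmul2l ?expn_gt0.
Qed.

Lemma exists_subset_card (T : finType) (A : {set T}) k : k <= #|A| ->
  exists2 B : {set T}, B \subset A & #|B| = k.
Proof.
move=> kA; exists [set x in take k (enum A)].
  by apply/subsetP => x; rewrite inE => /mem_take; rewrite mem_enum.
rewrite cardsE; have /card_uniqP -> : uniq (take k (enum A)) by rewrite take_uniq ?enum_uniq.
by rewrite size_takel // -cardE.
Qed.

(* X minimises sum_o min(w, |W o :&: X|) + c * |~: X|. *)
Lemma rich_core (T O : finType) (W : O -> {set T}) (w c : nat) :
  exists X : {set T},
    (forall v, v \in X -> #|[set o | (v \in W o) && (#|W o :&: X| <= w)]| <= c) /\
    c * #|~: X| <= #|O| * w.
Proof.
pose G (X : {set T}) := \sum_o minn w #|W o :&: X| + c * #|~: X|.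
have [X _ Xmin] := @arg_minnP {set T} setT xpredT G isT.
exists X; split=> [v vX|]; last first.
  (* Comparison with the full set, whose value is at most |O| w, bounds the complement of X. *)
  have := Xmin setT isT; rewrite /G setCT cards0 muln0 addn0 => h.
  apply: leq_trans (leq_trans (leq_addl _ _) h) _.
  rewrite -sum_nat_const; apply: leq_sum => o _; exact: geq_minl.
(* Removing v lowers the sum by one for each o that is counted in the claim, and raises the other
   term by c. *)
have := Xmin (X :\ v) isT; rewrite /G.
have -> : #|~: (X :\ v)| = #|~: X|.+1.
  rewrite setDE setCI setCK setUC cardsU1 inE vX; lia.
rewrite mulnS => h; set Y := [set o | _].
have : \sum_o minn w #|W o :&: (X :\ v)| + #|Y| <= \sum_o minn w #|W o :&: X|; last lia.
rewrite -sum1_card [X in _ + X]big_mkcond /=.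
rewrite -big_split /=; apply: leq_sum => o _; rewrite inE.
have [vW|vW] := boolP (v \in W o) => /=.
  have := cardsD1 v (W o :&: X); rewrite setIDA inE vW vX /=.
  by move=> ->; set z := #|_|; rewrite /minn; do 3! case: ifP; lia.
rewrite addn0 leq_min geq_minl /=; apply: leq_trans (geq_minr _ _) _.
by apply: subset_leq_card; apply: setIS; exact: subD1set.
Qed.

(** First-moment argument by counting, with all entries of the lists free. A pair (A, B) of sizes
    exactly h is bad if no list of a member of B meets A, which holds for a fraction (1 - h/N)^(hK)
    of all S. There are at most 2^(N + m) pairs, and larger sets contain sets of size h. *)
Lemma robust_template (N m K h : nat) : h <= N -> h <= m -> 0 < N ->
  2 ^ (N + m) * (N - h) ^ (h * K) < N ^ (h * K) ->
  exists S : 'I_m -> 'I_K -> 'I_N, forall (A : {set 'I_N}) (B : {set 'I_m}),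
    h <= #|A| -> h <= #|B| -> exists g i, g \in B /\ S g i \in A.
Proof.
move=> hN hm N0 H.
pose FT := {ffun 'I_m * 'I_K -> 'I_N}.
pose bad (p : {set 'I_N} * {set 'I_m}) : {set FT} :=
  [set f : FT | [forall x, (x.1 \in p.2) ==> (f x \notin p.1)]].
have badE (p : {set 'I_N} * {set 'I_m}) : #|p.1| = h -> #|p.2| = h ->
    #|bad p| = (N - h) ^ (h * K) * N ^ ((m - h) * K).
  move=> p1 p2.
  have -> : #|bad p| = #|family (fun x : 'I_m * 'I_K =>
      [pred a : 'I_N | (x.1 \in p.2) ==> (a \notin p.1)])|.
    apply: eq_card => f; rewrite inE; apply/forallP/familyP => [hf x|hf x].
      by rewrite inE; apply: hf.
    by have := hf x; rewrite inE.
  rewrite card_family foldrE big_image /=.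
  rewrite (eq_bigr (fun x : 'I_m * 'I_K => if x.1 \in p.2 then N - h else N)); last first.
    move=> x _; case: ifP => hx.
      rewrite -p1 -[X in X - _](card_ord N) -(cardC (mem p.1)) addKn.
      by apply: eq_card => a; rewrite !inE.
    by rewrite -[RHS](card_ord N); apply: eq_card.
  rewrite (eq_bigl xpredT) //.
  rewrite -(pair_bigA _ (fun g (_ : 'I_K) => if g \in p.2 then N - h else N)) /=.
  rewrite (eq_bigr (fun g : 'I_m => (if g \in p.2 then N - h else N) ^ K)); last first.
    by move=> g _; rewrite prod_nat_const card_ord.
  rewrite (bigID (mem p.2)) /=.
  rewrite (eq_bigr (fun=> (N - h) ^ K)); last by move=> g ->.
  rewrite [X in _ * X](eq_bigr (fun=> N ^ K)); last by move=> g /negbTE ->.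
  rewrite !prod_nat_const p2 -!expnM mulnC [K * h]mulnC mulnC [K * _]mulnC.
  suff -> : #|[pred g | g \notin p.2]| = m - h by [].
  by rewrite -p2 -[X in X - _](card_ord m) -(cardC (mem p.2)) addKn; apply: eq_card.
pose P := [pred p : {set 'I_N} * {set 'I_m} | (#|p.1| == h) && (#|p.2| == h)].
have lt : #|\bigcup_(p | P p) bad p| < #|FT|.
  apply: (@leq_ltn_trans (\sum_(p | P p) #|bad p|)).
    elim/big_rec2: _ => [|p x y _ IH]; first by rewrite cards0.
    apply: leq_trans (leq_of_leqif (leq_card_setU _ _)) _; by rewrite leq_add2l.
  rewrite (eq_bigr (fun=> (N - h) ^ (h * K) * N ^ ((m - h) * K))); last first.
    by move=> p /andP [/eqP p1 /eqP p2]; exact: badE.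
  rewrite sum_nat_const card_ffun card_prod !card_ord.
  have -> : m * K = h * K + (m - h) * K by rewrite -mulnDl subnKC.
  rewrite expnD mulnA ltn_pmul2r ?expn_gt0 ?N0 //; apply: leq_ltn_trans H.
  rewrite leq_mul2r; apply/orP; right; apply: leq_trans (max_card _) _.
  have cs (T : finType) : #|{set T}| = 2 ^ #|T|.
    by have := card_powerset [set: T]; rewrite powersetT !cardsT => <-.
  by rewrite card_prod !cs !card_ord expnD.
have [f /negP fN] : exists f, f \notin \bigcup_(p | P p) bad p.
  apply/existsP; apply: contraLR lt; rewrite negb_exists -leqNgt => /forallP h1.
  by apply: subset_leq_card; apply/subsetP => f _; have := h1 f; rewrite negbK.
exists (fun g i => f (g, i)) => A B hA hB.
have [A' A'A cA] := exists_subset_card hA.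
have [B' B'B cB] := exists_subset_card hB.
have : f \notin bad (A', B').
  apply/negP => hf; apply: fN; apply/bigcupP; exists (A', B') => //=.
  by rewrite /= cA cB !eqxx.
rewrite inE negb_forall => /existsP [[g i]] /=; rewrite negb_imply negbK => /andP [gB fA].
by exists g, i; split; [apply: (subsetP B'B) | apply: (subsetP A'A)].
Qed.

(* A permutation with the most pairs in R has no other pairs: such a pair could
   be repaired by rotating the images of at most three points. *)
Lemma expander_matching (X : finType) (R : rel X) (h : nat) :
  (forall y, h <= #|[set x | R x y]|) ->
  (forall x, h <= #|[set y | R x y]|) ->
  (forall A B : {set X}, h <= #|A| -> h <= #|B| -> exists x y, [/\ x \in B, y \in A & R x y]) ->
  exists s : {perm X}, forall x, R x (s x).
Proof.
move=> Hc Hr Hj.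
pose good (s : {perm X}) := [set x | R x (s x)].
have [s _ smax] := @arg_maxnP {perm X} 1%g xpredT (fun s => #|good s|) isT.
exists s => x0; apply: contraT => bad0.
have [b1 [y [b1B yA Rby]]] : exists x y,
    [/\ x \in [set x | R x0 (s x)], y \in [set s x | x in [set x | R x (s x0)]] & R x y].
  apply: Hj; first by rewrite card_imset //; exact: perm_inj.
  apply: leq_trans (Hr x0) _; rewrite -(card_imset [set x | R x0 (s x)] (@perm_inj _ s)).
  apply: subset_leq_card; apply/subsetP => y; rewrite inE => Ry.
  by apply/imsetP; exists ((s^-1)%g y); rewrite ?inE permKV.
case/imsetP: yA => g1; rewrite !inE in b1B * => Rg1 yE; subst y.
have g10 : g1 != x0 by apply: contraNneq bad0 => e; rewrite -?e in Rg1 b1B *.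
have b10 : b1 != x0 by apply: contraNneq bad0 => e; rewrite -?e in Rg1 b1B *.
(* This sends x0 to [s b1], b1 to [s g1] and g1 to [s x0]. If b1 = g1 it only exchanges the images
   of x0 and g1. All the new pairs lie in R, and x0 becomes good. *)
pose t := (tperm x0 g1 * tperm g1 b1 * s)%g.
have tE x : t x = s (tperm g1 b1 (tperm x0 g1 x)) by rewrite !permM.
have /= := smax t isT; rewrite leqNgt => /negP []; apply: proper_card.
apply/properP; split; last first.
  exists x0; last by rewrite inE.
  by rewrite inE tE tpermL tpermL.
apply/subsetP => x; rewrite !inE tE => Rx.
have [->|xg] := eqVneq x g1.
  by rewrite tpermR tpermD // eq_sym // eq_sym.
have [->|x0x] := eqVneq x x0; first by rewrite tpermL tpermL.
rewrite (tpermD (z := x)) 1?eq_sym //.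
have [->|xb] := eqVneq x b1; first by rewrite tpermR.
by rewrite tpermD // eq_sym.
Qed.

(** * Walks in joined digraphs *)

(** The flag is the direction in which the edge is traversed, so that an oriented cycle becomes a
    boolean sequence along a closed walk. *)
Definition adj (T : finType) (D : {set T * T}) (b : bool) (x y : T) : bool :=
  if b then (x, y) \in D else (y, x) \in D.

Definition nbr (T : finType) (D : {set T * T}) (b : bool) (x : T) : {set T} :=
  [set y | adj D b x y].

Definition joined (T : finType) (D : {set T * T}) (e : nat) : Prop :=
  forall A B : {set T}, [disjoint A & B] -> e <= #|A| -> e <= #|B| ->
    exists x y, [/\ x \in A, y \in B & (x, y) \in D].

(** The offset [i] is the position of [x] in the pattern [b]: segments of the cycle can be built
    separately, each with the directions of its own place. *)
Fixpoint walk (T : finType) (D : {set T * T}) (b : nat -> bool) (i : nat) (x : T)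
    (s : seq T) : bool :=
  if s is y :: s' then adj D (b i) x y && walk D b i.+1 y s' else true.

Section Joined.

Variables (T : finType) (D : {set T * T}).
Implicit Types (b : nat -> bool) (c : bool) (x y v : T) (F X Y W : {set T}).

Lemma adjN c x y : adj D (~~ c) x y = adj D c y x.
Proof. by case: c. Qed.

Lemma walk_cat b i x s1 s2 :
  walk D b i x (s1 ++ s2) = walk D b i x s1 && walk D b (i + size s1) (last x s1) s2.
Proof.
elim: s1 i x => [|y s1 IH] i x /=; first by rewrite addn0.
by rewrite IH addSnnS andbA.
Qed.

Lemma walk_rcons b i x s y :
  walk D b i x (rcons s y) = walk D b i x s && adj D (b (i + size s)) (last x s) y.
Proof. by rewrite -cats1 walk_cat /= andbT. Qed.

Lemma walk_nth b i x s : walk D b i x s -> forall j, j < size s ->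
  adj D (b (i + j)) (nth x (x :: s) j) (nth x s j).
Proof.
elim: s i x => [|y s IH] i x //= /andP [xy ys] [|j] hj; first by rewrite addn0.
have := IH _ _ ys j hj; rewrite addSnnS.
by rewrite (set_nth_default x) //= ?(set_nth_default x y) //; apply: ltnW.
Qed.

Lemma greedy_path b i k x : (forall c v, k < #|nbr D c v|) ->
  exists s, [/\ size s = k, uniq (x :: s) & walk D b i x s].
Proof.
elim: k => [|k IH] H; first by exists [::].
have [|s [s1 s2 s3]] := IH; first by move=> c v; apply: ltn_trans (H c v).
have /subsetPn [y yN yF] : ~~ (nbr D (b (i + k)) (last x s) \subset [set z in x :: s]).
  apply/negP => /subset_leq_card; rewrite leqNgt => /negP []; apply: leq_trans (H _ _).
  by rewrite ltnS cardsE; apply: leq_trans (card_size _) _; rewrite /= s1.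
exists (rcons s y); split; first by rewrite size_rcons s1.
  by rewrite -rcons_cons rcons_uniq s2 andbT; rewrite inE in yF.
by rewrite walk_rcons s3 s1; rewrite inE in yN.
Qed.

Variable e : nat.
Hypothesis joinedD : joined D e.

Lemma joined_adj c X Y : [disjoint X & Y] -> e <= #|X| -> e <= #|Y| ->
  exists x y, [/\ x \in X, y \in Y & adj D c x y].
Proof.
move=> dXY hX hY; case: c; first exact: joinedD.
rewrite disjoint_sym in dXY; have [y [x [yY xX h]]] := joinedD dXY hY hX.
by exists x, y.
Qed.

(** Disjointness is bought by a factor 2: after e vertices of X are set aside, at least e others
    remain in Y. *)
Lemma joined_link c X Y : 2 * e <= #|X| -> 2 * e <= #|Y| ->
  exists x y, [/\ x \in X, y \in Y, x != y & adj D c x y].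
Proof.
move=> hX hY; have [|X' sX cX] := @exists_subset_card _ X e; first lia.
have [|||x [y [xX yY xy]]] := @joined_adj c X' (Y :\: X').
- by rewrite disjoint_sym -setI_eq0 setIDAC setDIl setDv setI0.
- by rewrite cX.
- by have := cardsID X' Y; have := subset_leq_card (subsetIr Y X'); lia.
exists x, y; move: yY; rewrite inE => /andP [yX yY]; split=> //.
  exact: (subsetP sX).
by apply: contraNneq yX => <-.
Qed.

(** Any two vertices with large neighbourhoods outside the used set F can be linked by three edges
    of prescribed directions. The middle edge comes from [joined_link] applied to these
    neighbourhoods. *)
Lemma connector c1 c2 c3 u v F :
  2 * e <= #|nbr D c1 u :\: F| -> 2 * e <= #|nbr D (~~ c3) v :\: F| ->
  exists r r', [/\ r != r', r \notin F & r' \notin F] /\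
    [/\ adj D c1 u r, adj D c2 r r' & adj D c3 r' v].
Proof.
move=> h1 h2; have [r [r' [rX rY rr' a]]] := joined_link c2 h1 h2.
move: rX rY; rewrite !inE adjN => /andP [r1 r2] /andP [r3 r4].
by exists r, r'.
Qed.

Lemma joined_few c X Y : e <= #|X| -> [disjoint X & Y] -> 0 < e ->
  #|[set y in Y | [forall x in X, ~~ adj D c x y]]| < e.
Proof.
move=> hX dXY e0; rewrite ltnNge; apply/negP => hY.
have [|x [y [xX]]] := @joined_adj c X _ _ hX hY.
  by apply: disjointWr dXY; apply/subsetP => y; rewrite inE => /andP [].
by rewrite inE => /andP [_ /forall_inP /(_ x xX) /negP].
Qed.

(* The gap (x, y) can be filled by v or by d. Since the two neighbourhoods of v
   are joined to all large sets, fewer than 2e vertices d have to be avoided. *)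
Lemma swap_slot c1 c2 v W F : 0 < e ->
  2 * e <= #|W :\: F| -> 4 * e <= #|nbr D (~~ c1) v :\: F| ->
  4 * e <= #|nbr D c2 v :\: F| ->
  exists d x y, [/\ uniq [:: d; x; y], d \notin F, x \notin F, y \notin F & d \in W] /\
    [/\ adj D c1 x v, adj D c2 v y, adj D c1 x d & adj D c2 d y].
Proof.
move=> e0 hW hX hY.
have cI (A B : {set T}) : #|A| <= #|A :\: B| + #|B|.
  by rewrite -(cardsID B A); have := subset_leq_card (subsetIr A B); lia.
have [W' sW cW] := exists_subset_card hW.
have [|Y' sY cY] := @exists_subset_card _ ((nbr D c2 v :\: F) :\: W') e.
  by have := cI (nbr D c2 v :\: F) W'; lia.
(* Of the 4e available neighbours, 2e may be lost to [W'] and e to [Y'], so e remain. Fewer than e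
   vertices of [W'] miss [X'] and fewer than e miss [Y'], hence one of its 2e vertices serves as
   [d]. *)
pose X' := ((nbr D (~~ c1) v :\: F) :\: W') :\: Y'.
have cX : e <= #|X'|.
  have := cI (nbr D (~~ c1) v :\: F) W'.
  by have := cI ((nbr D (~~ c1) v :\: F) :\: W') Y'; rewrite -/X'; lia.
have dX : [disjoint X' & W'].
  by rewrite -setI_eq0; apply/eqP/setP => z; rewrite !inE; case: (z \in W'); rewrite ?andbF.
have dY : [disjoint Y' & W'].
  rewrite -setI_eq0; apply/eqP/setP => z; rewrite !inE.
  case zY: (z \in Y') => //=; have := subsetP sY _ zY.
  by rewrite inE => /andP [/negbTE].
have f1 := joined_few c1 cX dX e0.
have f2 := @joined_few (~~ c2) _ _ (eq_leq (esym cY)) dY e0.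
set D1 := [set y in W' | _] in f1; set D2 := [set y in W' | _] in f2.
have /subsetPn [d dW dN] : ~~ (W' \subset D1 :|: D2).
  apply/negP => /subset_leq_card.
  have := leq_of_leqif (leq_card_setU D1 D2); lia.
move: dN; rewrite !inE negb_or dW /= !negb_forall.
case/andP => /existsP [x]; rewrite negb_imply negbK => /andP [xX xd].
case/existsP => y; rewrite negb_imply negbK adjN => /andP [yY dy].
exists d, x, y.
have := subsetP sW _ dW; rewrite inE => /andP [dF dW0].
have := xX; rewrite !inE adjN => /and4P [xY xW xF xv].
have := subsetP sY _ yY; rewrite !inE => /and3P [yW yF vy].
split; split=> //=; rewrite negb_or !andbT -andbA.
apply/and3P; split; [by apply: contraNneq xW => <-| |by apply: contraNneq xY => ->].
by apply: contraNneq yW => <-.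
Qed.

Let pwalk b i (p : seq T) := if p is x :: s then walk D b i x s else true.

(* Depth-first search: a dead end goes to Z c, where c is the direction in which
   it has no neighbour left in the unexplored set U. As long as U has e vertices,
   fewer than e vertices have been discarded in either direction. *)
Lemma long_path b i k (P : {set T}) : 0 < e -> k.+1 + 3 * e <= #|P| ->
  exists x s, [/\ size s = k, uniq (x :: s), {subset x :: s <= P} & walk D b i x s].
Proof.
move=> e0 hP; set K := k.+1 in hP.
suff [p [p1 p2 p3 p4]] : exists p, [/\ size p = K, uniq p, {subset p <= P} & pwalk b i p].
  by case: p p1 p2 p3 p4 => // x s [s1] s2 s3 s4; exists x, s.
(* State of the search: current path [p], discarded sets [Z], unexplored set [U]. The measure 2|U| +
   |p| drops by one both when a vertex enters the path and when the end of the path is discarded. *)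
suff H n : forall (p : seq T) (Z : bool -> {set T}) (U : {set T}),
    2 * #|U| + size p <= n -> uniq p -> pwalk b i p -> size p <= K -> {subset p <= P} ->
    U \subset P -> (forall x, x \in p -> x \notin U) ->
    (forall c x, x \in Z c -> x \notin U /\ x \notin p) ->
    (forall c x y, x \in Z c -> y \in U -> ~~ adj D c x y) ->
    #|P| <= size p + (#|Z true| + #|Z false|) + #|U| -> e <= #|U| ->
    exists p, [/\ size p = K, uniq p, {subset p <= P} & pwalk b i p].
  apply: (H (2 * #|P|) [::] (fun=> set0) P) => //; rewrite ?addn0 ?cards0 ?add0n //.
  - by move=> c x; rewrite inE.
  - by move=> c x y; rewrite inE.
  - lia.
elim: n => [|n IH] p Z U hn Up wp pK pP UP pU ZU Zadj hcard hU; first lia.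
have [pEK|pNK] := eqVneq (size p) K; first by exists p.
have few c : #|Z c| < e.
  rewrite ltnNge; apply/negP => hZ.
  have [|x [y [xZ yU]]] := @joined_adj c (Z c) U _ hZ hU.
    rewrite -setI_eq0; apply/eqP/setP => z; rewrite !inE.
    by case zZ: (z \in Z c) => //=; case: (ZU _ _ zZ) => /negbTE.
  by apply/negP; apply: Zadj.
(* The path has fewer than K vertices and the two discarded sets fewer than e each, out of at least
   K + 3e. So U keeps at least e vertices after one more is taken. *)
have hU' : e < #|U| by have := few true; have := few false; lia.
have cU y : y \in U -> #|U| = (#|U :\ y|).+1 by move=> yU; rewrite (cardsD1 y U) yU.
have extend y : y \in U -> pwalk b i (rcons p y) ->
    exists p, [/\ size p = K, uniq p, {subset p <= P} & pwalk b i p].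
  move=> yU wpy; have := cU y yU => cy.
  apply: (IH (rcons p y) Z (U :\ y)) => //; rewrite ?size_rcons; try lia.
  - by rewrite rcons_uniq Up andbT; apply/negP => /pU; rewrite yU.
  - by move=> z; rewrite mem_rcons inE => /predU1P [->|/pP //]; apply: (subsetP UP).
  - by apply: subset_trans (subD1set _ _) UP.
  - move=> z; rewrite mem_rcons !inE => /predU1P [->|zp]; first by rewrite eqxx.
    by rewrite negb_and (pU _ zp) orbT.
  - move=> c z zZ; have [zU zp] := ZU _ _ zZ; rewrite !inE mem_rcons inE negb_or zp.
    rewrite negb_and zU orbT andbT; split=> //.
    by apply: contraNneq zU => ->.
  - by move=> c u z uZ; rewrite inE => /andP [_]; apply: Zadj.
case: (lastP p) Up wp pK pP pU ZU hcard pNK hn extend =>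
  [|q x] Up wp pK pP pU ZU hcard pNK hn extend.
  have /card_gt0P [y yU] : 0 < #|U| by lia.
  exact: (extend y).
rewrite size_rcons in hn pK hcard pNK.
pose c0 := b (i + size q).
have [/exists_inP [y yU xy]|/exists_inPn hx] := boolP [exists y in U, adj D c0 x y].
  apply: (extend y) => //; case: q {hn Up pK pP pU ZU hcard pNK extend} wp @c0 xy => [|z q] /=.
    by rewrite addn0 => _ ->.
  by rewrite !walk_rcons last_rcons size_rcons => -> ->.
have := Up; rewrite rcons_uniq => /andP [xq Uq].
have xZ c : x \notin Z c.
  by apply/negP => /ZU [_]; rewrite mem_rcons mem_head.
apply: (IH q (fun c => if c == c0 then x |: Z c else Z c) U) => //; try lia.
- case: q {hn Up pK pP pU ZU hcard pNK extend xq Uq} wp @c0 hx => //= z q.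
  by rewrite walk_rcons => /andP [].
- by move=> z zq; apply: pP; rewrite mem_rcons inE zq orbT.
- by move=> z zq; apply: pU; rewrite mem_rcons inE zq orbT.
- move=> c z; have hz : z \in Z c -> z \notin U /\ z \notin q.
    by case/ZU => ->; rewrite mem_rcons inE negb_or => /andP [_ ->].
  case: eqP => // _; rewrite inE => /orP [|//]; rewrite inE => /eqP ->; split=> //.
  by apply: pU; rewrite mem_rcons mem_head.
- move=> c z y; case: eqP => [->|_]; last exact: Zadj.
  rewrite inE => /orP [|zZ]; last exact: Zadj.
  by rewrite inE => /eqP -> /hx.
- have := cardsU1 x (Z true); have := cardsU1 x (Z false); rewrite !xZ.
  by case: c0 {hx}; rewrite /=; lia.
Qed.

End Joined.

(** * Pieces of the cycle, closed walks and assembly *)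

Section Pieces.
Variables (T : finType) (D : {set T * T}).
Implicit Types (b : nat -> bool).

(* Piece j occupies the positions 5j, ..., 5j+4 of the cycle: a gap (X j, Y j)
   filled by F j, and a link R j, R' j to the next piece. *)
Definition pieces (X F Y R R' : nat -> T) (N : nat) : seq T :=
  flatten [seq [:: X j; F j; Y j; R j; R' j] | j <- iota 0 N].

Lemma size_pieces X F Y R R' N : size (pieces X F Y R R' N) = 5 * N.
Proof.
rewrite /pieces; elim: N => [//|N IH].
by rewrite -addn1 iotaD map_cat flatten_cat size_cat IH /=; lia.
Qed.

Lemma mem_pieces X F Y R R' N j z : j < N ->
  z \in [:: X j; F j; Y j; R j; R' j] -> z \in pieces X F Y R R' N.
Proof.
move=> jN hz; apply/flattenP; exists [:: X j; F j; Y j; R j; R' j] => //.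
by apply/mapP; exists j => //; rewrite mem_iota.
Qed.

(** [X N] is the vertex following the last piece, where its link ends. [behead] drops the starting
    vertex [X 0], which [walk] takes separately. *)
Lemma walk_pieces b X F Y R R' N :
  (forall j, j < N ->
    [/\ adj D (b (5 * j)) (X j) (F j), adj D (b (5 * j + 1)) (F j) (Y j),
        adj D (b (5 * j + 2)) (Y j) (R j), adj D (b (5 * j + 3)) (R j) (R' j)
      & adj D (b (5 * j + 4)) (R' j) (X j.+1)]) ->
  walk D b 0 (X 0) (behead (rcons (pieces X F Y R R' N) (X N))).
Proof.
elim: N => [//|N IH] H.
have E : rcons (pieces X F Y R R' N.+1) (X N.+1) =
    rcons (pieces X F Y R R' N) (X N) ++ [:: F N; Y N; R N; R' N; X N.+1].
  rewrite /pieces -addn1 iotaD map_cat flatten_cat /= add0n.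
  by rewrite -!cats1 -!catA.
rewrite E; have -> s s' : 0 < size s -> behead (s ++ s') = behead s ++ s' :> seq T by case: s.
  rewrite walk_cat IH /=; last by move=> j jN; apply: H; lia.
  have -> : last (X 0) (behead (rcons (pieces X F Y R R' N) (X N))) = X N.
    case: N {IH H E} => [//|N]; rewrite /pieces /=; by rewrite !last_rcons.
  rewrite size_behead size_rcons size_pieces /= add0n.
  have [h1 h2 h3 h4 h5] := H N (ltnSn N).
  rewrite addn1 in h2; rewrite addn2 in h3; rewrite addn3 in h4; rewrite addn4 in h5.
  by rewrite h1 h2 h3 h4 h5.
by rewrite size_rcons.
Qed.

(** A greedy path on l - 2 vertices is closed by the two inner vertices of a connector. *)
Lemma short_cycle e b l : joined D e -> 3 <= l ->
  (forall c v, l + 2 * e <= #|nbr D c v|) ->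
  forall x, exists s, [/\ size (x :: s) = l, uniq (x :: s) & walk D b 0 x (rcons s x)].
Proof.
move=> Je l3 H x.
have [|s [s1 s2 s3]] := @greedy_path _ D b 0 (l - 3) x.
  by move=> c v; have := H c v; lia.
pose F := [set z in x :: s].
have cF c v : 2 * e <= #|nbr D c v :\: F|.
  have := cardsID F (nbr D c v); have := subset_leq_card (subsetIr (nbr D c v) F).
  have : #|F| <= l - 2.
    by rewrite cardsE; apply: leq_trans (card_size _) _; rewrite /= s1; lia.
  by have := H c v; lia.
have [r [r' [[h1 h2 h3] [h4 h5 h6]]]] :=
  @connector _ _ _ Je (b (l - 3)) (b (l - 3).+1) (b (l - 3).+2) (last x s) x F (cF _ _) (cF _ _).
exists (s ++ [:: r; r']); split.
- by rewrite /= size_cat s1 /=; lia.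
- rewrite -cat_cons cat_uniq s2 /= inE in h2 h3 *; rewrite inE in h3.
  by rewrite negb_or h2 negb_or h3 inE h1.
- by rewrite rcons_cat walk_cat s3 /= s1 add0n h4 h5 h6.
Qed.
End Pieces.

(** The pattern says at i whether H has the edge from i to its successor; the existential only turns
    the natural number i into an ordinal. Where it says no, an edge of H must run backwards, as an
    orientation has exactly one of the two. *)
Lemma contains_walk (T : finType) (D : {set T * T}) (l : nat) (H : {set 'I_l * 'I_l}) x s :
  3 <= l -> oriented_cycle H -> size (x :: s) = l -> uniq (x :: s) ->
  walk D (fun i => [exists k : 'I_l, (k == i :> nat) && ((k, ordS k) \in H)]) 0 x (rcons s x) ->
  contains D H.
Proof.
move=> l3 oH sl us wH.
have {oH} oH : is_orientation (@cycle_adj l) H.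
  by move: oH; rewrite /oriented_cycle; case: eqP; [lia | case: (3 <= l)].
pose f (i : 'I_l) := nth x (x :: s) i.
have step (i : 'I_l) : adj D ((i, ordS i) \in H) (f i) (f (ordS i)).
  have il : i < size (rcons s x) by rewrite size_rcons -[(size s).+1]/(size (x :: s)) sl.
  have := walk_nth wH il; rewrite add0n.
  have -> : [exists k : 'I_l, (k == i :> nat) && ((k, ordS k) \in H)] = ((i, ordS i) \in H).
    apply/existsP/idP => [[k /andP [/eqP ki hk]]|hi]; last by exists i; rewrite eqxx.
    by have -> : i = k by apply/val_inj.
  have -> : nth x (x :: rcons s x) i = f i.
    by rewrite -rcons_cons nth_rcons sl ltn_ord.
  have -> // : nth x (rcons s x) i = f (ordS i).
  rewrite /f /= nth_rcons; have hi : i < (size s).+1 by rewrite -(size_rcons s x).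
  have sl' : (size s).+1 = l by [].
  case: (ssrnat.ltngtP i (size s)) => [lt|gt|eqi]; last first.
  - by rewrite eqi sl' modnn.
  - by move: gt hi; lia.
  - by rewrite modn_small //; lia.
apply/existsP; exists (finfun f); apply/andP; split.
  apply/injectiveP => i j; rewrite !ffunE => /eqP.
  by rewrite nth_uniq ?sl // => /eqP /val_inj.
apply/forall_inP => -[i j] ijH /=; rewrite !ffunE.
move/forallP: oH => oH; have /forallP /(_ j) := oH i; have /forallP /(_ i) := oH j.
have -> : cycle_adj j i = cycle_adj i j by rewrite /cycle_adj orbC.
rewrite ijH; case: ifP => // /orP [/eqP jE|/eqP iE].
  by move=> _ _; have := step i; rewrite -jE ijH.
rewrite addbT => jiH _; have := step j.
by rewrite -iE (negbTE jiH).
Qed.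

(* Pieces 0, ..., M-1 form the absorber and the next s ones cover leftover
   vertices, with ends in L; then come the long path and a closing link.
   The numbers of vertices match exactly, so that distinctness follows by
   counting: the cycle visits all of own, the path and the leftover. *)
Lemma assemble_cycle (T : finType) (D : {set T * T}) (e : nat) (b : nat -> bool)
    (M m s l : nat) (dl L : seq T) (X Y R R' : nat -> T) :
  joined D e -> 0 < e -> 3 * e <= s ->
  0 < m -> m <= M ->
  uniq ([seq X j | j <- iota 0 M] ++ [seq Y j | j <- iota 0 M] ++
        [seq R j | j <- iota 0 M.-1] ++ [seq R' j | j <- iota 0 M.-1] ++ dl ++ L) ->
  size dl = M - m -> size L = m + 4 * s + 4 ->
  (forall c v, 2 * e + 4 * s + 4 <= #|nbr D c v :&: [set z in L]|) ->
  (forall j, j.+1 < M ->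
    [/\ adj D (b (5 * j + 2)) (Y j) (R j), adj D (b (5 * j + 3)) (R j) (R' j)
      & adj D (b (5 * j + 4)) (R' j) (X j.+1)]) ->
  (forall L', uniq L' -> {subset L' <= L} -> size L' = m ->
    exists F : nat -> T, {subset dl ++ L' <= [seq F j | j <- iota 0 M]} /\
      forall j, j < M -> adj D (b (5 * j)) (X j) (F j) /\ adj D (b (5 * j + 1)) (F j) (Y j)) ->
  5 * (M + s) + 3 <= l -> l <= #|T| ->
  exists x t, [/\ size (x :: t) = l, uniq (x :: t) & walk D b 0 x (rcons t x)].
Proof.
move=> Je e0 es m0 mM Uown sdl sL cL HR HF hl lT.
set own := _ ++ _ in Uown.
have sown : size own = 5 * M + 4 * s + 2.
  by rewrite /own !size_cat !size_map !size_iota sdl sL; lia.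
(* The cycle consists of M + s pieces of five vertices, a path with k + 1 vertices and two closing
   vertices. *)
pose k := l - 5 * (M + s) - 3.
pose P : {set T} := ~: [set z in own].
have cown : #|[set z in own]| = 5 * M + 4 * s + 2.
  by rewrite cardsE -sown; apply/card_uniqP.
have cP : #|P| = #|T| - (5 * M + 4 * s + 2) by rewrite cardsCs setCK cown.
have [|xq [sq [q1 q2 q3 q4]]] := @long_path _ _ _ Je b (5 * (M + s)) k P e0.
  by rewrite cP /k; lia.
pose Q := [set z in xq :: sq].
have cQ : #|Q| = k.+1 by rewrite cardsE -q1; apply/card_uniqP.
(* As l <= |T|, at least s vertices outside [own] are missed by the path. When l = |T| these are
   exactly the leftover. *)
have [|Us sUs cUs] := @exists_subset_card _ (P :\: Q) s.
  have := cardsID Q P; have := subset_leq_card (subsetIr P Q).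
  by rewrite cP cQ /k; lia.
pose u j := nth xq (enum Us) j.
pose L0 := [set z in L].
have cut c v (F : {set T}) : 2 * e + 4 * s + 4 <= #|nbr D c v :\: (~: L0 :|: F)| + #|F|.
  apply: leq_trans (cL c v) _.
  apply: leq_trans (leq_of_leqif (leq_card_setU _ _)); apply: subset_leq_card.
  apply/subsetP => z; rewrite !inE negb_or negbK => /andP [-> ->].
  by case: (z \in F).
have pick c v (F : {set T}) : #|F| < 2 * e + 4 * s + 4 ->
    exists z, [/\ z \in L, z \notin F & adj D c v z].
  move=> hF; have /card_gt0P [z] : 0 < #|nbr D c v :\: (~: L0 :|: F)|.
    by have := cut c v F; lia.
  by rewrite !inE negb_or negbK => /andP [/andP [z1 z2] z3]; exists z.
(* The j-th leftover vertex fills the gap of piece M + j, whose two ends are taken from L. This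
   spends 2s vertices of L. *)
have [|St [St1 St2]] := @greedy_blocks T nat 2 (fun j t =>
    [/\ {subset t <= L}, adj D (b (5 * (M + j))) (nth xq t 0) (u j)
      & adj D (b (5 * (M + j) + 1)) (u j) (nth xq t 1)]) (iota 0 s) (iota_uniq _ _).
  move=> j F _; rewrite size_iota => hF.
  have [|z [z1 z2 z3]] := pick (~~ b (5 * (M + j))) (u j) F; first lia.
  have [|z' [z1' z2' z3']] := pick (b (5 * (M + j) + 1)) (u j) (z |: F).
    by have := leq_of_leqif (leq_card_setU [set z] F); rewrite cards1; lia.
  rewrite !inE negb_or in z2'; case/andP: z2' => zz zF.
  exists [:: z; z']; split=> //=.
  - by rewrite inE eq_sym zz.
  - by move=> y; rewrite !inE => /orP [] /eqP ->.
  - by rewrite -adjN; split=> // y; rewrite !inE => /orP [] /eqP ->.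
set stars := flatten _ in St2.
have sstars : size stars = 2 * s.
  rewrite /stars; have : {in iota 0 s, forall j, size (St j) = 2} by move=> j /St1 [].
  rewrite -{3}(size_iota 0 s); elim: (iota 0 s) => //= i r IH hr.
  rewrite size_cat IH ?hr ?mem_head //; first lia.
  by move=> j jr; apply: hr; rewrite inE jr orbT.
have cstars : #|[set z in stars]| = 2 * s by rewrite cardsE -sstars; apply/card_uniqP.
(* Index M + s stands for the long path, entered at [xq] and left at [last xq sq]. The link after
   index j starts at position [o j] and leads to [dst j], which is [X 0] for the closing link. *)
pose XX j := if j < M then X j else if j < M + s then nth xq (St (j - M)) 0 else xq.
pose YY j := if j < M then Y j else if j < M + s then nth xq (St (j - M)) 1 else last xq sq.
pose dst j := if j < M + s then XX j.+1 else X 0.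
pose o j := if j < M + s then 5 * j + 2 else 5 * (M + s) + k.
(* There are s + 2 links still missing: after the last piece of the absorber, after each of the s
   new pieces, and after the path. They spend 2(s + 2) more vertices of L, so exactly m are left for
   the absorber. *)
have [|Co [Co1 Co2]] := @greedy_blocks T nat 2 (fun j t =>
    [/\ {subset t <= L}, {in t, forall z, z \notin stars},
      adj D (b (o j)) (YY j) (nth xq t 0),
      adj D (b (o j).+1) (nth xq t 0) (nth xq t 1)
      & adj D (b (o j).+2) (nth xq t 1) (dst j)]) (iota M.-1 (s + 2)) (iota_uniq _ _).
  move=> j F _; rewrite size_iota => hF.
  pose F' := [set z in stars] :|: F.
  have cF' : #|F'| <= 2 * s + #|F|.
    by rewrite -cstars; exact: leq_of_leqif (leq_card_setU _ _).
  have h c v : 2 * e <= #|nbr D c v :\: (~: L0 :|: F')| by have := cut c v F'; lia.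
  have [r [r' [[h1 h2 h3] [h4 h5 h6]]]] :=
    @connector _ _ _ Je (b (o j)) (b (o j).+1) (b (o j).+2) (YY j) (dst j) _ (h _ _) (h _ _).
  rewrite !inE !negb_or !negbK in h2 h3.
  case/and3P: h2 => r1 r2 r3; case/and3P: h3 => r1' r2' r3'.
  exists [:: r; r']; split=> //=.
  - by rewrite inE h1.
  - by move=> y; rewrite !inE => /orP [] /eqP ->.
  - by split=> // y; rewrite !inE => /orP [] /eqP ->.
set conns := flatten _ in Co2.
have sconns : size conns = 2 * (s + 2).
  rewrite /conns; have : {in iota M.-1 (s + 2), forall j, size (Co j) = 2} by move=> j /Co1 [].
  rewrite -{3}(size_iota M.-1 (s + 2)); elim: (iota _ _) => //= i r IH hr.
  rewrite size_cat IH ?hr ?mem_head //; first lia.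
  by move=> j jr; apply: hr; rewrite inE jr orbT.
have starsL : {subset stars <= L}.
  by move=> z /flattenP [t /mapP [j jS ->] zt]; case: (St1 j jS) => _ [h _ _]; apply: h.
have connsL z : z \in conns -> z \in L /\ z \notin stars.
  case/flattenP=> t /mapP [j jS ->] zt; case: (Co1 j jS) => _ [h h' _ _ _].
  by split; [apply: h | apply: h'].
pose Z := stars ++ conns.
have UL : uniq L by move: Uown; rewrite /own !catA cat_uniq => /and3P [].
have UZ : uniq Z.
  by rewrite cat_uniq St2 Co2 andbT; apply/hasPn => z /connsL [].
have ZL : {subset Z <= L}.
  by move=> z; rewrite mem_cat => /orP [/starsL|/connsL []].
pose L' := [seq z <- L | z \notin Z].
have sL' : size L' = m.
  have := count_predC (mem Z) L; rewrite sL.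
  have -> : count (mem Z) L = size Z.
    rewrite -size_filter; apply: perm_size; apply: uniq_perm => //; first exact: filter_uniq.
    by move=> z; rewrite mem_filter /=; case zZ: (z \in Z) => //=; apply: ZL.
  have -> : count (predC (mem Z)) L = size L' by rewrite size_filter.
  by rewrite size_cat sstars sconns; lia.
have [||//|F [F1 F2]] := HF L'; first exact: filter_uniq.
  by move=> z; rewrite mem_filter => /andP [].
pose FF j := if j < M then F j else u (j - M).
pose RR j := if j < M.-1 then R j else nth xq (Co j) 0.
pose RR' j := if j < M.-1 then R' j else nth xq (Co j) 1.
have M0 : 0 < M by lia.
have stepC j : M.-1 <= j <= M + s ->
  [/\ adj D (b (o j)) (YY j) (RR j), adj D (b (o j).+1) (RR j) (RR' j)
    & adj D (b (o j).+2) (RR' j) (dst j)].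
  move=> hj; have jS : j \in iota M.-1 (s + 2) by rewrite mem_iota; lia.
  case: (Co1 j jS) => _ [_ _ c1 c2 c3].
  by rewrite /RR /RR' ltnNge; case/andP: hj => ->.
have stepP j : j < M + s ->
    [/\ adj D (b (5 * j)) (XX j) (FF j), adj D (b (5 * j + 1)) (FF j) (YY j),
        adj D (b (5 * j + 2)) (YY j) (RR j), adj D (b (5 * j + 3)) (RR j) (RR' j)
      & adj D (b (5 * j + 4)) (RR' j) (XX j.+1)].
  move=> hj.
  have [h1 h2] : adj D (b (5 * j)) (XX j) (FF j) /\ adj D (b (5 * j + 1)) (FF j) (YY j).
    rewrite /XX /FF /YY hj; case: (ssrnat.ltnP j M) => jM; first exact: F2.
    have jS : j - M \in iota 0 s by rewrite mem_iota; lia.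
    by case: (St1 _ jS) => _ [_]; rewrite subnKC.
  have [h3 h4 h5] : [/\ adj D (b (5 * j + 2)) (YY j) (RR j),
      adj D (b (5 * j + 3)) (RR j) (RR' j) & adj D (b (5 * j + 4)) (RR' j) (XX j.+1)].
    case: (ssrnat.ltnP j M.-1) => jM.
      have jM' : j.+1 < M by rewrite -(prednK M0) ltnS.
      by rewrite /YY /RR /RR' /XX jM jM' (ltnW jM'); exact: HR.
    have [|c1 c2 c3] := stepC j; first by rewrite jM ltnW.
    by move: c1 c2 c3; rewrite /o /dst hj -!addnS.
  by split.
pose N := M + s.
pose t := behead (rcons (pieces XX FF YY RR RR' N) xq) ++ sq ++ [:: RR N; RR' N].
have XN : XX N = xq by rewrite /XX /N; rewrite ltnNge leq_addr ltnn.
have NE : N.-1.+1 = N by rewrite prednK // ltn_addr.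
have X0 : XX 0 = X 0 by rewrite /XX M0.
have tE : XX 0 :: t = pieces XX FF YY RR RR' N ++ (xq :: sq) ++ [:: RR N; RR' N].
  rewrite /t -{1 4}NE.
  by rewrite /pieces /= -!cats1 -!catA.
exists (XX 0), t.
have st : size (XX 0 :: t) = l.
  by rewrite tE !size_cat size_pieces /= q1 /N /k; lia.
split=> //; last first.
  rewrite /t rcons_cat walk_cat -XN walk_pieces; last exact: stepP.
  have -> : last (XX 0) (behead (rcons (pieces XX FF YY RR RR' N) (XX N))) = xq.
    rewrite -{1}NE.
    by rewrite /pieces /= last_rcons XN.
  rewrite size_behead size_rcons size_pieces /= rcons_cat walk_cat add0n q4 q1.
  have [|c1 c2 c3] := stepC N; first by rewrite /N; lia.
  move: c1 c2 c3; rewrite /o /dst /YY /N ltnn.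
  have -> : (M + s < M) = false by lia.
  by move=> c1 c2 c3; rewrite /= X0 c1 c2 c3.
(* These are (5M + 4s + 2) + (k + 1) + s = l distinct vertices. All of them are visited by a walk
   with l entries, which therefore has no repetition. *)
pose s1 := own ++ (xq :: sq) ++ enum Us.
have Us1 : uniq s1.
  rewrite cat_uniq Uown cat_uniq q2 enum_uniq !andTb andbT; apply/andP; split.
    rewrite has_cat negb_or; apply/andP; split; apply/hasPn => z.
      by move=> /q3; rewrite !inE.
    by rewrite mem_enum => /(subsetP sUs); rewrite !inE => /andP [_].
  apply/hasPn => z; rewrite mem_enum => /(subsetP sUs).
  by rewrite !inE => /andP [].
have mp j z : j < N -> z \in [:: XX j; FF j; YY j; RR j; RR' j] -> z \in XX 0 :: t.
  by move=> jN hz; rewrite tE mem_cat (mem_pieces jN hz).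
have hMN i : (M + i < M) = false by rewrite ltnNge leq_addr.
have ltN i : i < M -> i < N by move=> h; apply: leq_trans h (leq_addr _ _).
have ltN' i : i < M.-1 -> i < N by move=> h; apply: ltN; apply: leq_trans h (leq_pred _).
have NS : M.-1 + (s + 2) = N.+1 by rewrite addn2 !addnS -addSn prednK.
have sub : {subset s1 <= XX 0 :: t}.
  have hL' z : z \in dl ++ L' -> z \in XX 0 :: t.
    move=> /F1 /mapP [j]; rewrite mem_iota add0n => /= jM ->.
    by apply: (mp j); [exact: ltN | rewrite !inE /FF jM eqxx ?orbT].
  have hst z : z \in stars -> z \in XX 0 :: t.
    case/flattenP => w /mapP [j jS ->]; case: (St1 j jS) => sz _ zj.
    have jN : M + j < N by move: jS; rewrite mem_iota add0n ltn_add2l.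
    apply: (mp _ _ jN).
    have : z \in [:: nth xq (St j) 0; nth xq (St j) 1].
      by move: sz zj; case: (St j) => [|z1 [|z2 []]].
    rewrite !inE /XX /YY.
    rewrite hMN jN.
    by rewrite addKn => /orP [] ->; rewrite ?orbT.
  have hco z : z \in conns -> z \in XX 0 :: t.
    case/flattenP => w /mapP [j jS ->]; case: (Co1 j jS) => sz _ zj.
    have : z \in [:: nth xq (Co j) 0; nth xq (Co j) 1].
      by move: sz zj; case: (Co j) => [|z1 [|z2 []]].
    move: jS; rewrite mem_iota NS => /andP [jS1 jS2].
    have jM : (j < M.-1) = false by rewrite ltnNge jS1.
    have [-> |jN] := eqVneq j N.
      have NM : (N < M.-1) = false by rewrite ltnNge (leq_trans (leq_pred M) (leq_addr s M)).
      rewrite tE !mem_cat /RR /RR' NM => ->; by rewrite !orbT.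
    have jN' : j < N by rewrite ltn_neqAle jN -ltnS.
    move=> hz; apply: (mp _ _ jN'); move: hz; rewrite !inE /RR /RR' jM.
    by case/orP => ->; rewrite ?orbT.
  move=> z; rewrite mem_cat => /orP [zown|].
    move: zown; rewrite !mem_cat.
    case/or4P => [/mapP [j]|/mapP [j]|/mapP [j]|].
    - rewrite mem_iota add0n => /= jM ->.
      by apply: (mp j); [exact: ltN | rewrite !inE /XX jM eqxx].
    - rewrite mem_iota add0n => /= jM ->.
      by apply: (mp j); [exact: ltN | rewrite !inE /YY jM eqxx ?orbT].
    - rewrite mem_iota add0n => /= jM ->.
      by apply: (mp j); [exact: ltN' | rewrite !inE /RR jM eqxx ?orbT].
    case/or3P => [/mapP [j]|zd|zL].
    - rewrite mem_iota add0n => /= jM ->.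
      by apply: (mp j); [exact: ltN' | rewrite !inE /RR' jM eqxx ?orbT].
    - by apply: hL'; rewrite mem_cat zd.
    have [|zZ] := boolP (z \in Z).
      by rewrite mem_cat => /orP [/hst|/hco].
    by apply: hL'; rewrite mem_cat mem_filter zZ zL orbT.
  rewrite mem_cat => /orP [zq|].
    by rewrite tE mem_cat mem_cat zq orbT.
  rewrite mem_enum => zU; pose i := index z (enum Us).
  have iS : i < s by rewrite -cUs cardE index_mem mem_enum.
  apply: (mp (M + i)); first by rewrite /N ltn_add2l.
  rewrite !inE /FF; rewrite hMN.
  by rewrite addKn /u nth_index ?mem_enum // eqxx orbT.
apply: (leq_size_uniq Us1 sub).
by rewrite st /s1 size_cat sown size_cat /= q1 -cardE cUs /k; lia.
Qed.

(** * The absorber *)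

Lemma count_zip_iota (T : Type) (x0 : T) (m : nat) (P : pred (nat * T)) s : size s = m ->
  count P (zip (iota 0 m) s) = #|[set g : 'I_m | P (nat_of_ord g, nth x0 s g)]|.
Proof.
move=> sm; have -> : zip (iota 0 m) s = [seq (nat_of_ord g, nth x0 s g) | g <- enum 'I_m].
  have -> : [seq (nat_of_ord g, nth x0 s g) | g <- enum 'I_m] =
      [seq (i, nth x0 s i) | i <- iota 0 m].
    by rewrite -val_enum_ord -map_comp.
  apply: (@eq_from_nth _ (0, x0)) => [|i].
    by rewrite size_zip size_map size_iota sm minnn.
  rewrite size_zip size_iota sm minnn => im.
  rewrite nth_zip ?size_iota ?sm // (nth_map 0) ?size_iota //.
  by rewrite nth_iota.
rewrite count_map -size_filter cardE; congr size.
by rewrite [RHS]/enum_mem -enumT; apply: eq_filter => g; rewrite /= inE.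
Qed.

(** Weighted sampling without repetition: excluding the fewer than N elements already drawn leaves
    each [Fam i :&: P] with at least |T|/c elements. *)
Lemma sample_subset (T I : finType) (i0 : I) (P : {set T}) (Fam : I -> {set T})
    (c N h : nat) :
  0 < c -> (forall i, #|T| + c * N <= c * #|Fam i :&: P|) -> 4 * c * h <= N ->
  #|I| < 2 ^ h ->
  exists L, [/\ uniq L, size L = N, {subset L <= P} &
    forall i, h <= #|Fam i :&: [set z in L]|].
Proof.
move=> c0 H hN hI.
have h0 : 0 < h.
  by have : 0 < #|I| by [apply/card_gt0P; exists i0]; case: h hI {hN}; rewrite ?expn0; lia.
have N0 : 0 < N by apply: leq_trans hN; rewrite !muln_gt0 c0 h0.
have /card_gt0P [o0 _] : 0 < #|Fam i0 :&: P|.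
  have := H i0; case: (#|_ :&: _|) => // ; rewrite muln0; have := muln_gt0 c N; rewrite c0 N0; lia.
pose Inv s := uniq s && all (mem P) s.
have [|s Is sN|s [s1 /andP [s2 /allP s3] s4]] :=
    @weighted_sampling T I Inv (fun _ i a => a \in Fam i) c N h i0 o0 c0 _ _ hN hI.
- by [].
- move=> i; set A := [set a | _].
  have sub : Fam i :&: P :\: [set z in s] \subset A.
    apply/subsetP => a; rewrite !inE => /and3P [as1 aF aP].
    move: Is; rewrite /Inv => /andP [us Ps].
    by rewrite /Inv rcons_uniq as1 us all_rcons Ps /= aP aF.
  have := subset_leq_card sub; have := cardsID [set z in s] (Fam i :&: P).
  have := subset_leq_card (subsetIr (Fam i :&: P) [set z in s]).
  have : #|[set z in s]| <= size s by rewrite cardsE card_size.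
  have := H i; nia.
exists s; split=> // i; apply: leq_trans (s4 i) _.
have -> : count (fun p : nat * T => p.2 \in Fam i) (zip (iota 0 N) s) = count (mem (Fam i)) s.
  rewrite -[in RHS](@unzip2_zip _ _ (iota 0 N) s) ?size_iota ?s1 //.
  by rewrite count_map.
rewrite -size_filter -(card_uniqP (filter_uniq _ s2)); apply: subset_leq_card.
by apply/subsetP => z; rewrite mem_filter !inE => /andP [-> ->].
Qed.

Definition mid (T : finType) (D : {set T * T}) (c c' : bool) (x y : T) : {set T} :=
  [set v | adj D c x v && adj D c' v y].

(** [mid] collects the vertices that can fill a gap. Among the pairs (x, y) having v between them,
    at most [pc] are poor, at most 4m|T| reuse a chosen vertex and |T| are diagonal. The degree
    hypothesis leaves a 1/c fraction of all pairs, and weighted sampling applies. *)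
Lemma sample_pairs (T : finType) (D : {set T * T}) (m h c pc w : nat) (X : {set T})
    (ca cb : 'I_m -> bool) :
  0 < c -> X != set0 ->
  (forall v, v \in X -> #|[set o : (bool * bool) * (T * T) |
     (v \in mid D o.1.1 o.1.2 o.2.1 o.2.2) &&
     (#|mid D o.1.1 o.1.2 o.2.1 o.2.2 :&: X| <= w)]| <= pc) ->
  (forall d d' v, #|T| * #|T| + c * (pc + (4 * m + 1) * #|T|) <=
    c * (#|nbr D d v| * #|nbr D d' v|)) ->
  4 * c * h <= m -> #|T| < 2 ^ h ->
  exists x y : 'I_m -> T,
    [/\ uniq ([seq x g | g <- enum 'I_m] ++ [seq y g | g <- enum 'I_m]),
        forall g, w < #|mid D (ca g) (cb g) (x g) (y g) :&: X|
      & forall v, v \in X -> h <= #|[set g | v \in mid D (ca g) (cb g) (x g) (y g)]|].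
Proof.
move=> c0 /set0Pn [v0 v0X] Hpoor Hdeg hm hT.
pose ext (f : 'I_m -> bool) i := if insub i is Some g then f g else false.
pose Mi i (p : T * T) := mid D (ext ca i) (ext cb i) p.1 p.2.
pose rich := fun q : nat * (T * T) => w < #|Mi q.1 q.2 :&: X|.
pose Inv (s : seq (T * T)) :=
  uniq (map fst s ++ map snd s) && all rich (zip (iota 0 (size s)) s).
(* Vertices outside X count as always hit, so that the sampling can be indexed by all of T. *)
pose hit i (v : T) p := (v \in X) ==> (v \in Mi i p).
have key s v : Inv s -> size s < m -> v \in X ->
    #|{: T * T}| <= c * #|[set p | Inv (rcons s p) && (v \in Mi (size s) p)]|.
  move=> Is sm vX; set A := [set p | _]; set i := size s.
  case/andP: (Is) => us rs.
  pose U := [set z in map fst s ++ map snd s].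
  have cU : #|U| <= 2 * m.
    by rewrite cardsE; apply: leq_trans (card_size _) _; rewrite size_cat !size_map; lia.
  pose V := setX (nbr D (~~ ext ca i) v) (nbr D (ext cb i) v).
  pose poor := [set p : T * T | (v \in Mi i p) && (#|Mi i p :&: X| <= w)].
  have cpoor : #|poor| <= pc.
    apply: leq_trans (Hpoor v vX).
    have inj : injective (fun p : T * T => ((ext ca i, ext cb i), p)) by move=> p p' [].
    rewrite -(card_imset _ inj); apply: subset_leq_card; apply/subsetP => o.
    by case/imsetP => p; rewrite !inE => hp ->.
  have sub : V \subset A :|: poor :|: setX U setT :|: setX setT U :|: [set (z, z) | z in T].
    apply/subsetP => -[x y]; rewrite 2!inE /= adjN => /andP [vx].
    rewrite inE => vy.
    have vM : v \in Mi i (x, y) by rewrite inE /= vx vy.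
    rewrite !in_setU; case: (boolP ((x, y) \in poor)); first by rewrite !orbT.
    rewrite [in X in X -> _]inE vM /= -ltnNge => xyr.
    rewrite !in_setX !in_setT andbT /=.
    have [xU|xU] := boolP (x \in U); first by rewrite !orbT.
    have [yU|yU] := boolP (y \in U); first by rewrite !orbT.
    have [->|xy] := eqVneq x y.
      by apply/orP; right; apply/imsetP; exists y.
    rewrite inE vM andbT !orbF; apply/orP; left; apply/andP; split.
      have -> : uniq (map fst (rcons s (x, y)) ++ map snd (rcons s (x, y))) =
                uniq (x :: y :: map fst s ++ map snd s).
        apply: perm_uniq; apply/seq.permP => a.
        by rewrite !map_rcons -!cats1 /= !count_cat /=; clear; lia.
      rewrite inE in xU; rewrite inE in yU.
      by rewrite /= inE negb_or xy xU yU us.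
    rewrite size_rcons -addn1 iotaD /= add0n cats1 zip_rcons ?size_iota // all_rcons rs andbT.
    exact: xyr.
  have cV : #|V| <= #|A| + pc + (4 * m + 1) * #|T|.
    apply: leq_trans (subset_leq_card sub) _.
    have u1 := leq_of_leqif (leq_card_setU (A :|: poor :|: setX U setT :|: setX setT U)
      [set (z, z) | z in T]).
    have u2 := leq_of_leqif (leq_card_setU (A :|: poor :|: setX U setT) (setX setT U)).
    have u3 := leq_of_leqif (leq_card_setU (A :|: poor) (setX U setT)).
    have u4 := leq_of_leqif (leq_card_setU A poor).
    rewrite !cardsX !cardsT in u1 u2 u3.
    have u5 : #|[set (z, z) | z in T]| <= #|T| by apply: leq_imset_card.
    have u6 := leq_mul cU (leqnn #|T|).
    clear - u1 u2 u3 u4 u5 u6 cpoor.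
    have -> : (4 * m + 1) * #|T| = 2 * m * #|T| + 2 * m * #|T| + #|T| by lia.
    rewrite [#|T| * #|U|]mulnC in u2 *; lia.
  rewrite card_prod; have := Hdeg (~~ ext ca i) (ext cb i) v; rewrite -cardsX -/V => hd.
  have := leq_mul (leqnn c) cV; clear - hd; rewrite !mulnDr in hd *; lia.
have [|s Is sm v|s [s1 s2 s3]] := @weighted_sampling _ T Inv hit c m h v0 (v0, v0) c0 _ _ hm hT.
- by [].
- case: (boolP (v \in X)) => vX.
    apply: leq_trans (key s v Is sm vX) _; rewrite leq_mul2l; apply/orP; right.
    by apply: subset_leq_card; apply/subsetP => p; rewrite /hit !inE vX.
  apply: leq_trans (key s v0 Is sm v0X) _; rewrite leq_mul2l; apply/orP; right.
  apply: subset_leq_card; apply/subsetP => p; rewrite /hit !inE (negbTE vX) /=.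
  by case/andP => ->.
have extE (f : 'I_m -> bool) (g : 'I_m) : ext f g = f g by rewrite /ext valK.
case/andP: s2 => us rs.
have mapE (A : Type) (f : T * T -> A) :
    [seq f (nth (v0, v0) s (nat_of_ord g)) | g <- enum 'I_m] = map f s.
  have -> : [seq f (nth (v0, v0) s (nat_of_ord g)) | g <- enum 'I_m] =
      [seq f (nth (v0, v0) s i) | i <- iota 0 m].
    by rewrite -val_enum_ord -map_comp.
  by rewrite -s1 map_comp -/(mkseq _ _) mkseq_nth.
exists (fun g : 'I_m => (nth (v0, v0) s g).1), (fun g : 'I_m => (nth (v0, v0) s g).2); split.
- by rewrite !mapE.
- move=> g; have gs : g < size s by rewrite s1.
  move/(all_nthP (0, (v0, v0))): rs => /(_ g).
  rewrite size_zip size_iota minnn => /(_ gs).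
  by rewrite nth_zip ?size_iota // nth_iota //= /rich /Mi /= !extE.
- move=> v vX; apply: leq_trans (s3 v) _.
  rewrite (@count_zip_iota _ (v0, v0)) //; apply: subset_leq_card.
  by apply/subsetP => g; rewrite !inE /hit /Mi vX /= inE !extE.
Qed.

(* Gadget g consists of the main gap (g, None) and of the gaps (g, Some i),
   filled by d (g, i) or by v g i. *)
Lemma absorber (T : finType) (D : {set T * T}) (e : nat) (b : nat -> bool)
    (m K h h2 q w pc c1 c2 : nat) (X : {set T}) :
  joined D e -> 0 < e -> 0 < m -> X != set0 -> 0 < c1 -> 0 < c2 ->
  (forall v, v \in X -> #|[set o : (bool * bool) * (T * T) |
     (v \in mid D o.1.1 o.1.2 o.2.1 o.2.2) &&
     (#|mid D o.1.1 o.1.2 o.2.1 o.2.2 :&: X| <= w)]| <= pc) ->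
  (forall d d' v, #|T| * #|T| + c1 * (pc + (4 * m + 1) * #|T|) <=
    c1 * (#|nbr D d v| * #|nbr D d' v|)) ->
  4 * c1 * h <= m -> #|T| < 2 ^ h ->
  (forall d v, #|T| + c2 * (m + q) + c2 * (2 * m) <= c2 * #|nbr D d v :&: X|) ->
  #|T| + c2 * (m + q) + c2 * (2 * m) <= c2 * w ->
  4 * c2 * h2 <= m + q -> 2 * #|T| + m < 2 ^ h2 -> h + q <= h2 -> h <= m ->
  2 ^ (m + q + m) * (m + q - h) ^ (h * K) < (m + q) ^ (h * K) ->
  (forall d v, 4 * e + 5 * (m * K.+1) + q <= #|nbr D d v|) ->
  4 * e + 5 * (m * K.+1) + q <= w ->
  exists (dl L : seq T) (XX YY RR RR' : nat -> T), let M := m * K.+1 in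
  [/\ uniq ([seq XX j | j <- iota 0 M] ++ [seq YY j | j <- iota 0 M] ++
        [seq RR j | j <- iota 0 M.-1] ++ [seq RR' j | j <- iota 0 M.-1] ++ dl ++ L),
      size dl = M - m /\ size L = m + q,
      forall c v, h2 <= #|nbr D c v :&: [set z in L]|,
      forall j, j.+1 < M ->
        [/\ adj D (b (5 * j + 2)) (YY j) (RR j), adj D (b (5 * j + 3)) (RR j) (RR' j)
          & adj D (b (5 * j + 4)) (RR' j) (XX j.+1)]
    & forall L', uniq L' -> {subset L' <= L} -> size L' = m ->
        exists F : nat -> T, {subset dl ++ L' <= [seq F j | j <- iota 0 M]} /\
          forall j, j < M ->
            adj D (b (5 * j)) (XX j) (F j) /\ adj D (b (5 * j + 1)) (F j) (YY j)].
Proof.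
move=> Je e0 m0 X0 c10 c20 Hpoor Hdeg hm1 hT HnX Hw hh2 hI hq hm Htemp Hnb Hw2.
have /set0Pn [t0 t0X] := X0.
pose J : finType := ('I_m * option 'I_K)%type.
have cJ : #|J| = m * K.+1 by rewrite card_prod card_option !card_ord.
pose M := m * K.+1.
(* The rank of a gap is the index of its piece on the cycle, and so fixes the directions of its two
   edges. *)
pose pos (j : J) : nat := enum_rank j.
have posM j : pos j < M by rewrite /M -cJ ltn_ord.
pose j0 : J := (Ordinal m0, None).
pose slot i : J := nth j0 (enum J) i.
have slotK j : slot (pos j) = j by rewrite /slot /pos nth_enum_rank.
have posK i : i < M -> pos (slot i) = i.
  move=> iM; have iJ : i < #|J| by rewrite cJ.
  rewrite /pos /slot -[i]/(val (Ordinal iJ)) -(enum_val_nth j0) enum_valK //.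
have [x0 [y0 [U0 rich0 hits0]]] := @sample_pairs T D m h c1 pc w X
  (fun g => b (5 * pos (g, None))) (fun g => b (5 * pos (g, None) + 1)) c10 X0 Hpoor Hdeg hm1 hT.
pose W g := mid D (b (5 * pos (g, None))) (b (5 * pos (g, None) + 1)) (x0 g) (y0 g).
pose A0 := [seq x0 g | g <- enum 'I_m] ++ [seq y0 g | g <- enum 'I_m].
have sA0 : size A0 = 2 * m by rewrite size_cat 2!size_map size_enum_ord; clear; lia.
have cA0 : #|[set z in A0]| <= 2 * m by rewrite cardsE -sA0 card_size.
have split3 (A B : {set T}) : #|A| <= #|A :\: B| + #|B|.
  by rewrite -(cardsID B A) addnC leq_add2l subset_leq_card ?subsetIr.
(* L must meet both the neighbourhoods, for the later links, and the sets [W g], for the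
   matching. *)
pose I := ((bool * T) + 'I_m)%type.
pose Fam (i : I) := match i with inl p => nbr D p.1 p.2 | inr g => W g end.
have [i|||L [UL sL LP HL]] := @sample_subset T I (inr (Ordinal m0)) (X :\: [set z in A0]) Fam
    c2 (m + q) h2 c20.
- have hF : #|T| + c2 * (m + q) + c2 * (2 * m) <= c2 * #|Fam i :&: X|.
    case: i => [[d v]|g] /=; first exact: HnX.
    by apply: leq_trans Hw _; rewrite leq_mul2l ltnW ?orbT //; exact: rich0.
  have := split3 (Fam i :&: X) [set z in A0]; rewrite setIDA => hs.
  have := leq_mul (leqnn c2) hs; have := leq_mul (leqnn c2) cA0.
  by rewrite mulnDr; clear - hF; lia.
- exact: hh2.
- by rewrite card_sum card_prod card_bool card_ord.
have LX z : z \in L -> z \in X by move=> /LP; rewrite inE => /andP [].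
have LA0 z : z \in L -> z \notin A0 by move=> /LP; rewrite !inE => /andP [].
have [||S HS] := @robust_template (m + q) m K h _ hm _ Htemp.
- by apply: leq_trans hm (leq_addr _ _).
- by apply: ltn_addr.
pose v g i := nth t0 L (S g i).
have vL g i : v g i \in L by apply: mem_nth; rewrite sL.
have Wbig g (F : {set T}) : #|F| <= 5 * (m * K.+1) + q -> 4 * e <= #|W g :\: F|.
  move=> hF; have := split3 (W g) F; have := rich0 g.
  have := subset_leq_card (subsetIl (W g) X); rewrite -/(W g).
  clear - hF Hw2; lia.
have nbig d z (F : {set T}) : #|F| <= 5 * (m * K.+1) + q -> 4 * e <= #|nbr D d z :\: F|.
  by move=> hF; have := split3 (nbr D d z) F; have := Hnb d z; clear - hF; lia.
pose JK : finType := ('I_m * 'I_K)%type.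
have cJK : #|JK| = m * K by rewrite card_prod !card_ord.
pose bs (p : JK) i := b (5 * pos (p.1, Some p.2) + i).
(* The block of (g, i) is [[:: d; x; y]]: a gap (x, y) which both [d] in [W g] and [v g i] can
   fill. *)
have [|Sw [Sw1 Sw2]] := @greedy_blocks T JK 3 (fun p s =>
    [/\ {in s, forall z, z \notin A0 ++ L}, nth t0 s 0 \in W p.1,
        adj D (bs p 0) (nth t0 s 1) (v p.1 p.2) /\ adj D (bs p 1) (v p.1 p.2) (nth t0 s 2),
        adj D (bs p 0) (nth t0 s 1) (nth t0 s 0)
      & adj D (bs p 1) (nth t0 s 0) (nth t0 s 2)]) (enum JK) (enum_uniq _).
  move=> p F _; rewrite -cardE cJK => hF.
  have cF : #|F :|: [set z in A0 ++ L]| <= 5 * (m * K.+1) + q.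
    apply: leq_trans (leq_of_leqif (leq_card_setU _ _)) _.
    have : #|[set z in A0 ++ L]| <= 2 * m + (m + q).
      by rewrite cardsE; apply: leq_trans (card_size _) _; rewrite size_cat sA0 sL.
    by move: hF; clear; rewrite mulnS; lia.
  have h2e : 2 * e <= #|W p.1 :\: (F :|: [set z in A0 ++ L])|.
    by apply: leq_trans (Wbig p.1 _ cF); rewrite leq_mul2r orbT.
  have [d [x [y [[u dF xF yF dW] [s1 s2 s3 s4]]]]] :=
    @swap_slot _ _ _ Je (bs p 0) (bs p 1) (v p.1 p.2) (W p.1) _ e0 h2e
      (nbig _ _ _ cF) (nbig _ _ _ cF).
  have nF z : z \notin F :|: [set z in A0 ++ L] -> z \notin F /\ z \notin A0 ++ L.
    by rewrite in_setU negb_or => /andP [z1 z2]; rewrite inE in z2.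
  case: (nF _ dF) (nF _ xF) (nF _ yF) => d1 d2 [x1 x2] [y1 y2].
  exists [:: d; x; y]; split=> //.
    by move=> z; rewrite !inE => /or3P [] /eqP ->.
  by split=> // z; rewrite !inE => /or3P [] /eqP ->.
set sw := flatten _ in Sw2.
have Sw1' p := Sw1 p (mem_enum _ p).
have ssw : size sw = 3 * (m * K).
  rewrite /sw -cJK cardE; elim: (enum JK) => //= p r IH.
  by rewrite size_cat IH; case: (Sw1' p) => -> _; rewrite mulnS.
have swN z : z \in sw -> z \notin A0 ++ L.
  by case/flattenP => s /mapP [p _ ->]; case: (Sw1' p) => _ [h0 _ _ _ _]; apply: h0.
pose Xs (j : J) := if j.2 is Some i then nth t0 (Sw (j.1, i)) 1 else x0 j.1.
pose Ys (j : J) := if j.2 is Some i then nth t0 (Sw (j.1, i)) 2 else y0 j.1.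
pose d p := nth t0 (Sw p) 0.
pose XX i := Xs (slot i).
pose YY i := Ys (slot i).
have [|Co [Co1 Co2]] := @greedy_blocks T nat 2 (fun j s =>
    [/\ {in s, forall z, z \notin A0 ++ L ++ sw},
        adj D (b (5 * j + 2)) (YY j) (nth t0 s 0),
        adj D (b (5 * j + 3)) (nth t0 s 0) (nth t0 s 1)
      & adj D (b (5 * j + 4)) (nth t0 s 1) (XX j.+1)]) (iota 0 M.-1) (iota_uniq _ _).
  move=> j F _; rewrite size_iota => hF.
  have cF : #|F :|: [set z in A0 ++ L ++ sw]| <= 5 * (m * K.+1) + q.
    apply: leq_trans (leq_of_leqif (leq_card_setU _ _)) _.
    have : #|[set z in A0 ++ L ++ sw]| <= 2 * m + (m + q) + 3 * (m * K).
      rewrite cardsE; apply: leq_trans (card_size _) _.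
      by rewrite size_cat sA0 size_cat sL ssw addnA.
    have : M.-1 <= m * K.+1 by exact: leq_pred.
    by move: hF; clear; rewrite mulnS; lia.
  have nb2 c z : 2 * e <= #|nbr D c z :\: (F :|: [set z in A0 ++ L ++ sw])|.
    by apply: leq_trans (nbig c z _ cF); rewrite leq_mul2r orbT.
  have [r [r' [[r1 r2 r3] [r4 r5 r6]]]] :=
    @connector _ _ _ Je (b (5 * j + 2)) (b (5 * j + 3)) (b (5 * j + 4)) (YY j) (XX j.+1) _
      (nb2 _ _) (nb2 _ _).
  have nF z : z \notin F :|: [set z in A0 ++ L ++ sw] -> z \notin F /\ z \notin A0 ++ L ++ sw.
    by rewrite in_setU negb_or => /andP [z1 z2]; rewrite inE in z2.
  case: (nF _ r2) (nF _ r3) => d1 d2 [x1 x2].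
  exists [:: r; r']; split=> //=.
  - by rewrite inE r1.
  - by move=> z; rewrite !inE => /orP [] /eqP ->.
  - by split=> // z; rewrite !inE => /orP [] /eqP ->.
set co := flatten _ in Co2.
have sco : size co = 2 * M.-1.
  rewrite /co; have : {in iota 0 M.-1, forall j, size (Co j) = 2} by move=> j /Co1 [].
  rewrite -[in RHS](size_iota 0 M.-1); elim: (iota 0 M.-1) => //= i r IH hr.
  rewrite size_cat IH ?hr ?mem_head ?mulnS //.
  by move=> j jr; apply: hr; rewrite inE jr orbT.
have coN z : z \in co -> z \notin A0 ++ L ++ sw.
  by case/flattenP => s /mapP [j jS ->]; case: (Co1 j jS) => _ [h0 _ _ _]; apply: h0.
pose RR j := nth t0 (Co j) 0.
pose RR' j := nth t0 (Co j) 1.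
pose dl := [seq d p | p <- enum JK].
exists dl, L, XX, YY, RR, RR' => /=; rewrite -/M.
have sdl : size dl = m * K by rewrite size_map -cardE cJK.
have memX (f : J -> T) (j : J) : f j \in [seq f (slot i) | i <- iota 0 M].
  by apply/mapP; exists (pos j); rewrite ?slotK // mem_iota add0n posM.
split.
(* The vertices were built as disjoint groups in another order. The list in the claim has the same
   size and contains all of them, hence has no repetition either. *)
- pose s1 := A0 ++ L ++ sw ++ co.
  have Us1 : uniq s1.
    rewrite /s1 cat_uniq U0 cat_uniq UL cat_uniq Sw2 Co2 !andTb !andbT.
    apply/and3P; split; apply/hasPn => z.
    + rewrite mem_cat => /orP [/LA0 //|]; rewrite mem_cat.
      by case/orP => [/swN|/coN]; rewrite mem_cat negb_or => /andP [].
    + rewrite mem_cat => /orP [/swN|/coN]; rewrite mem_cat negb_or => /andP [_] //.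
      by rewrite mem_cat negb_or => /andP [].
    + by move/coN; rewrite 2!mem_cat !negb_or => /and3P [].
  apply: (leq_size_uniq Us1).
    move=> z; rewrite /s1 !mem_cat => /or4P [|zL|zs|zc].
    + case/orP => /mapP [g _ ->].
        by rewrite (memX Xs (g, None)).
      by rewrite (memX Ys (g, None)) !orbT.
    + by rewrite zL !orbT.
    + case/flattenP: zs => s /mapP [[g i] _ ->] zs.
      have : z \in [:: d (g, i); Xs (g, Some i); Ys (g, Some i)].
        rewrite /d /Xs /Ys /=; case: (Sw1' (g, i)) => sz _.
        by move: sz zs; case: (Sw (g, i)) => [|z1 [|z2 [|z3 []]]].
      rewrite !inE => /or3P [] /eqP ->.
      * have -> : d (g, i) \in dl by apply: map_f; rewrite mem_enum.
        by rewrite !orbT.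
      * by rewrite memX.
      * by rewrite (memX Ys) !orbT.
    + case/flattenP: zc => s /mapP [j jS ->] zs.
      have : z \in [:: RR j; RR' j].
        rewrite /RR /RR'; case: (Co1 j jS) => sz _.
        by move: sz zs; case: (Co j) => [|z1 [|z2 []]].
      by rewrite !inE => /orP [] /eqP ->; rewrite map_f ?orbT.
  rewrite 5!size_cat sdl sL 4!size_map !size_iota.
  rewrite /s1 size_cat sA0 size_cat sL size_cat ssw sco /M mulnS.
  by clear; lia.
- by rewrite sdl sL /M mulnS addKn.
- by move=> c z; have := HL (inl (c, z)).
- move=> j jM; have jS : j \in iota 0 M.-1.
    by rewrite mem_iota add0n /= -ltnS prednK // (leq_ltn_trans _ jM).
  by case: (Co1 j jS) => _ [_].
move=> L' UL' L'L sL'.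
pose f0 (k : 'I_m) := nth t0 L' k.
have f0L' k : f0 k \in L' by apply: mem_nth; rewrite sL'.
have f0inj : injective f0.
  by move=> k k' /eqP; rewrite nth_uniq ?sL' // => /eqP /val_inj.
(* Gadgets are matched with L'. Each vertex is accepted by h gadgets by the choice of the pairs;
   each [W g] loses at most q of its [h2] vertices in L; large sets are joined by the template. *)
pose acc g z := (z \in W g) || [exists i, v g i == z].
have [k|g|A B hA hB|s Hs] := @expander_matching 'I_m (fun g k => acc g (f0 k)) h.
- apply: leq_trans (hits0 (f0 k) (LX _ (L'L _ (f0L' k)))) _.
  by apply: subset_leq_card; apply/subsetP => g; rewrite inE [in X in _ -> X]inE /acc => ->.
- have h3 : h2 <= #|W g :&: [set z in L']| + q.
    apply: leq_trans (HL (inr g)) _ => /=.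
    have : #|W g :&: [set z in L] :\: [set z in L']| <= q.
      have sub : [set z in L'] \subset [set z in L] by apply/subsetP => z; rewrite !inE; apply: L'L.
      have e1 : #|[set z in L]| = m + q by rewrite cardsE -sL; apply/card_uniqP.
      have e2 : #|[set z in L']| = m by rewrite cardsE -sL'; apply/card_uniqP.
      have := cardsD [set z in L] [set z in L']; rewrite (setIidPr sub) e1 e2 addKn => <-.
      by apply: subset_leq_card; apply: setSD; exact: subsetIr.
    rewrite -(cardsID [set z in L'] (W g :&: [set z in L])).
    move=> hb; apply: leq_add hb.
    by apply: subset_leq_card; apply: setSI; exact: subsetIl.
  have h4 : h <= #|W g :&: [set z in L']| by clear - h3 hq; lia.
  apply: leq_trans h4 _; rewrite -(card_imset _ f0inj); apply: subset_leq_card.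
  apply/subsetP => z; rewrite inE => /andP [zW]; rewrite inE => zL.
  have kz : index z L' < m by rewrite -sL' index_mem.
  apply/imsetP; exists (Ordinal kz); last by rewrite /f0 /= nth_index.
  by rewrite inE /acc /f0 /= nth_index // zW.
- pose A' := [set i : 'I_(m + q) | nth t0 L i \in f0 @: A].
  have cA' : h <= #|A'|.
    apply: leq_trans hA _; rewrite -(card_imset A f0inj).
    apply: leq_trans (leq_imset_card (fun i : 'I_(m + q) => nth t0 L i) A').
    apply: subset_leq_card; apply/subsetP => z zA.
    have zL : z \in L by case/imsetP: zA => k _ ->; exact/L'L/f0L'.
    have kz : index z L < m + q by rewrite -sL index_mem.
    apply/imsetP; exists (Ordinal kz); last by rewrite /= nth_index.
    by rewrite inE /= nth_index.
  have [g [i [gB]]] := HS A' B cA' hB.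
  rewrite inE => /imsetP [k kA e3]; exists g, k; split=> //.
  by apply/orP; right; apply/existsP; exists i; rewrite /v e3.
pose u g := f0 (s g).
(* If [u g] lies in [W g] it fills the main gap. Otherwise it is some [v g i]: it fills gap i, and
   the vertex d of that gap moves to the main gap. *)
pose o g : option 'I_K := if u g \in W g then None else [pick i | v g i == u g].
have oN g : o g = None -> u g \in W g.
  rewrite /o; case: ifP => // uW; case: pickP => // hn _.
  by have := Hs g; rewrite /acc -/(u g) uW => /existsP [i]; rewrite hn.
have oS g i : o g = Some i -> v g i = u g.
  by rewrite /o; case: ifP => // _; case: pickP => // i' /eqP hi [<-].
pose Fs (j : J) := match j.2 with
  | None => if o j.1 is Some i then d (j.1, i) else u j.1
  | Some i => if o j.1 == Some i then u j.1 else d (j.1, i) end.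
exists (fun i => Fs (slot i)); split.
  move=> z; rewrite mem_cat => /orP [/mapP [[g i] _ ->]|zL'].
    have [oi|oi] := eqVneq (o g) (Some i).
      by have := memX Fs (g, None); rewrite {1}/Fs /= oi.
    by have := memX Fs (g, Some i); rewrite {1}/Fs /= (negbTE oi).
  have kz : index z L' < m by rewrite -sL' index_mem.
  pose g := (s^-1)%g (Ordinal kz).
  have -> : z = u g by rewrite /u /g permKV /f0 /= nth_index.
  case oi : (o g) => [i|].
    by have := memX Fs (g, Some i); rewrite {1}/Fs /= oi eqxx.
  by have := memX Fs (g, None); rewrite {1}/Fs /= oi.
move=> j jM; rewrite /XX /YY -{1 4}(posK j jM); case: (slot j) => g [i|].
- case: (Sw1' (g, i)) => _ [_ _ [a1 a2] a3 a4].
  rewrite /bs addn0 /= in a1 a2 a3 a4.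
  rewrite /Fs /Xs /Ys /=; case: eqP => [/oS <-|_]; first by split.
  by split.
- have : Fs (g, None) \in W g.
    rewrite /Fs /=; case oi : (o g) => [i|]; last exact: oN.
    by case: (Sw1' (g, i)) => _ [].
  by rewrite inE => /andP.
Qed.

(** * All oriented cycles in a joined digraph *)

(** With v = 16c one has N <= 2m = vh, so 1 - h/N <= 1 - 1/v. The exponent is vk with k = 25ch,
    which gives a factor at most 2^(-k), and k exceeds 24ch = 3m >= N + m. *)
Lemma template_bound (c h m N : nat) : 0 < c -> 0 < h -> m = 8 * c * h -> m <= N -> N <= 2 * m ->
  2 ^ (N + m) * (N - h) ^ (h * (400 * c ^ 2)) < N ^ (h * (400 * c ^ 2)).
Proof.
move=> c0 h0 mE mN N2m.
pose v := 16 * c; pose k := 25 * c * h.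
have -> : h * (400 * c ^ 2) = v * k by rewrite /v /k; lia.
have v0 : 0 < v by rewrite /v; lia.
have k0 : 0 < k by rewrite /k !muln_gt0 c0 h0.
have hN : h < N by apply: leq_trans mN; rewrite mE; nia.
have step : v * (N - h) <= v.-1 * N.
  have : N <= v * h by rewrite /v; lia.
  case: v v0 => // u _ /=; rewrite mulnBr; nia.
have half : 2 ^ k * v.-1 ^ (v * k) <= v ^ (v * k).
  by rewrite !(expnM _ v k) -expnMn leq_exp2r // expn_pred_half.
have E0 : 0 < v * k by rewrite muln_gt0 v0.
have P0 : 0 < v ^ (v * k) by rewrite expn_gt0 v0.
rewrite -(ltn_pmul2l P0).
apply: (@leq_trans (v ^ (v * k) * (2 ^ k * (N - h) ^ (v * k)))).
  rewrite ltn_pmul2l // ltn_pmul2r ?expn_gt0 ?subn_gt0 ?hN //.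
  have : 0 < c * h by rewrite muln_gt0 c0.
  by rewrite ltn_exp2l // /k; clear - mE N2m; nia.
rewrite mulnCA -expnMn.
apply: (@leq_trans (2 ^ k * (v.-1 * N) ^ (v * k))).
  by rewrite leq_pmul2l ?expn_gt0 // leq_exp2r.
by rewrite expnMn mulnA leq_mul2r half orbT.
Qed.

(** The deterministic part. Here e is linear in |T|, and 2^e exceeding a multiple of |T| makes the
    families to be hit few enough for the sampling. *)
Theorem joined_digraph_cycles (a : nat) : 0 < a ->
  exists B, [/\ 0 < B, a <= B & forall (T : finType) (D : {set T * T}) (e : nat),
    0 < e -> B * e <= #|T| -> #|T| <= 2 * (B * e) -> 6 * (B * e) < 2 ^ e ->
    joined D e -> (forall c v, #|T| <= a * #|nbr D c v|) ->
    forall (b : nat -> bool) l, 3 <= l -> l <= #|T| ->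
    exists x t, [/\ size (x :: t) = l, uniq (x :: t) & walk D b 0 x (rcons t x)]].
Proof.
move=> a0; have [a3 a3E] : exists a3, a3 = a * a * a by eexists.
(* [c2] is the inverse density used to sample L, and K the list length asked by [template_bound]. B
   is such that B e = 64 a^3 w for the w below, so that w is a fixed fraction of |T|. *)
have [c2 c2E] : exists c2, c2 = 256 * a3 by eexists.
have [K KE] : exists K, K = 400 * c2 ^ 2 by eexists.
have [B BD] : exists B, B = 64 * a3 * (2560 * c2 * K.+1) by eexists.
have a30 : 0 < a3 by rewrite a3E !muln_gt0 a0.
have a2 : 0 < a * a by rewrite muln_gt0 a0.
have aa3 : a * a <= a3 by rewrite a3E leq_pmulr.
have aa2 : a <= a * a by rewrite leq_pmulr.
have c20 : 0 < c2 by rewrite c2E; clear - a30; lia.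
have K0 : 0 < K by rewrite KE muln_gt0 expn_gt0 c20.
exists B; split; first by rewrite BD !muln_gt0 a30 c20.
  have : 0 < 2560 * c2 * K.+1 by rewrite !muln_gt0 c20.
  by rewrite BD; move: aa2 aa3; clear; nia.
move=> T D e e0 nB nB2 hexp Je Hd b l l3 lT.
set n := #|T| in nB nB2 Hd lT *.
(* The depth-first search needs s = 3e spare vertices. Covering them uses q = 4s + 4 vertices of L;
   m is the number of gadgets, M that of gaps, and w the size above which a gap is rich. *)
pose h := 16 * e; pose s := 3 * e; pose q := 4 * s + 4; pose m := 8 * c2 * h.
pose M := m * K.+1; pose w := 20 * M.
(* A vertex lies between at least n^2/a^2 pairs. Half of this may be poor and a quarter may be
   spoiled by used vertices and the diagonal; a quarter remains. *)
pose c1 := 4 * (a * a).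
have h0 : 0 < h by rewrite /h; clear - e0; lia.
have c2a : 256 <= c2 by rewrite c2E; clear - a30; lia.
have hm : 2048 * h <= m by rewrite /m; clear - c2a; nia.
have m0 : 0 < m by apply: leq_trans hm; rewrite muln_gt0.
have mM : 2 * m <= M by rewrite /M mulnC leq_pmul2l // ltnS.
have BE : B * e = 64 * a3 * w by rewrite BD /w /M /m /h; clear; lia.
rewrite BE in nB nB2 hexp.
have qh : q <= h by rewrite /q /s /h; clear - e0; lia.
have eh : h = 16 * e by [].
have n1 : 1280 * (a3 * M) <= n by apply: leq_trans nB; rewrite /w; clear; lia.
have n2 : n <= 128 * (a3 * w) by apply: leq_trans nB2 _; clear; lia.
have aM : M <= a3 * M by rewrite leq_pmull.
have nexp : 3 * n < 2 ^ e.
  by apply: leq_ltn_trans hexp; clear - nB2; lia.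
have big c v : 1280 * M <= #|nbr D c v|.
  rewrite -(leq_pmul2l a0); apply: leq_trans (Hd c v); apply: leq_trans n1.
  by rewrite mulnCA !leq_mul2l leq_mul2r (leq_trans aa2 aa3) orbT.
have [small|large] := ssrnat.ltnP l (5 * (M + s) + 3).
  have [x _] : exists x : T, true.
    have /card_gt0P [x _] : 0 < #|T| by apply: leq_trans lT; apply: leq_trans l3.
    by exists x.
  have [|t [t1 t2 t3]] := @short_cycle T D e b l Je l3 _ x; last by exists x, t.
  move=> c v; apply: leq_trans (big c v).
  by clear - small mM hm e0; move: small; rewrite /s /h in hm *; lia.
pose pc := (n * n) %/ (2 * (a * a)).
pose mido (o : (bool * bool) * (T * T)) := mid D o.1.1 o.1.2 o.2.1 o.2.2.
have [X [HX1 HX2]] := @rich_core T _ mido w pc.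
have pc1 : pc * (2 * (a * a)) <= n * n by exact: leq_trunc_div.
have n0 : 0 < n by apply: leq_trans lT; apply: leq_trans l3.
have M0 : 0 < M by clear - m0 mM; lia.
have an : 1280 * (a * a) <= n.
  by apply: leq_trans n1; rewrite leq_mul2l (leq_trans aa3) ?orbT // leq_pmulr.
have pc2 : n * n <= pc * (4 * (a * a)).
  have := ltn_pmod (n * n) (_ : 0 < 2 * (a * a)); rewrite muln_gt0 a2 => /(_ isT).
  have := divn_eq (n * n) (2 * (a * a)); rewrite -/pc.
  have : 2 * (a * a) <= n * n.
    by apply: leq_trans (leq_trans an (leq_pmulr n n0)); clear; lia.
  set r := _ %% _; set p := a * a; clear - a2.
  case: pc => [|k]; first by rewrite mul0n; lia.
  by move=> h1 h2 h3; rewrite h2; nia.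
(* There are 4 n^2 directed gaps and pc >= n^2/(4 a^2), so at most 16 a^2 w <= n/(4a) vertices lie
   outside X. Neighbourhoods keep three quarters of the guaranteed n/a. *)
have cX : 4 * a * #|~: X| <= n.
  have : n * n * #|~: X| <= n * n * (16 * (a * a) * w).
    apply: (@leq_trans (4 * (a * a) * (pc * #|~: X|))).
      rewrite mulnA leq_mul2r; apply/orP; right; apply: leq_trans pc2 _.
      by rewrite mulnC.
    apply: leq_trans (leq_mul (leqnn _) HX2) _.
    rewrite !card_prod card_bool -/n; clear; lia.
  rewrite leq_pmul2l ?muln_gt0 ?n0 // => hX.
  apply: leq_trans nB; have := leq_mul (leqnn (4 * a)) hX.
  by rewrite a3E; clear; lia.
have nbX c v : 3 * n <= 4 * a * #|nbr D c v :&: X|.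
  have : #|nbr D c v| <= #|nbr D c v :&: X| + #|~: X|.
    by rewrite -(cardsID X (nbr D c v)) leq_add2l subset_leq_card // setDE subsetIr.
  move=> h1; have := leq_mul (leqnn (4 * a)) h1; rewrite mulnDr.
  have := Hd c v; clear - cX; lia.
have X0 : X != set0.
  apply: contraTneq cX => ->; rewrite setC0 cardsT -ltnNge -/n.
  by clear - n0 a0; nia.
have h4 : 1024 * (a3 * m) <= n by apply: leq_trans n1; clear - mM a30; nia.
have [|||||||||||||||dl [L [XX [YY [RR [RR' [A1 [A2 A2'] A3 A4 A5]]]]]]] :=
  @absorber T D e b m K h (2 * h) q w pc c1 c2 X Je e0 m0 X0.
- by rewrite /c1 muln_gt0 a2.
- exact: c20.
- exact: HX1.
- move=> d d' v; rewrite -/n.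
  have g1 : n * n <= a * a * (#|nbr D d v| * #|nbr D d' v|).
    by rewrite mulnACA leq_mul.
  have g2 : 4 * (a * a) * (4 * m + 1) <= n.
    apply: leq_trans n1; apply: (@leq_trans (4 * (a3 * (5 * m)))).
      rewrite -mulnA leq_mul2l /=; apply: leq_mul => //; clear - m0; lia.
    by clear - mM; nia.
  have g3 := leq_mul g2 (leqnn n).
  rewrite /c1 mulnDr; clear - g1 g3 pc1; lia.
- by rewrite /c1 /m c2E; clear - aa3; nia.
- apply: leq_ltn_trans (leq_trans nexp _); first by clear; rewrite /n; lia.
  by rewrite leq_exp2l // eh; clear; lia.
- move=> d v; rewrite -/n.
  have := nbX d v; rewrite c2E => h5.
  have h6 := leq_mul (leqnn (64 * (a * a))) h5.
  have h7 : n <= a * a * n by rewrite leq_pmull.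
  have h8 : 256 * a3 * (m + q) + 256 * a3 * (2 * m) <= 1024 * (a3 * m).
    have : q <= m by clear - qh hm; lia.
    by clear; nia.
  have -> : 256 * a3 * #|nbr D d v :&: X| = 64 * (a * a) * (4 * a * #|nbr D d v :&: X|).
    by rewrite a3E; clear; lia.
  apply: leq_trans h6; clear - h4 h7 h8; lia.
- rewrite -/n; have : q <= m by clear - qh hm; lia.
  have : c2 * w = 256 * (a3 * w) by rewrite c2E mulnA.
  have : c2 * (20 * (2 * m)) <= c2 * w by rewrite leq_mul2l /w leq_mul2l mM !orbT.
  by clear - n2; nia.
- by rewrite /m; clear; lia.
- apply: leq_ltn_trans (leq_trans nexp _); last by rewrite leq_exp2l // eh; clear; lia.
  by rewrite -/n; clear - mM n1 aM; lia.
- by clear - qh; lia.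
- by clear - hm; lia.
- by rewrite KE; apply: template_bound; rewrite ?leq_addr //; clear - qh hm; lia.
- move=> d v; apply: leq_trans (big d v).
  by rewrite -/M; clear - mM hm qh eh; lia.
- by rewrite /w -/M; clear - mM hm qh eh; lia.
apply: (@assemble_cycle T D e b M m s l dl L XX YY RR RR') => //.
- by clear - mM; lia.
- by rewrite A2' /q addnA.
- move=> c v; apply: leq_trans (A3 c v); rewrite -addnA -/q.
  by clear - qh eh; lia.
Qed.

(** * The random digraph *)

Lemma contains_two_cycle (T : finType) (D : {set T * T}) (l : nat) (H : {set 'I_l * 'I_l}) x y :
  l = 2 -> oriented_cycle H -> x != y -> (x, y) \in D -> (y, x) \in D -> contains D H.
Proof.
move=> l2; subst l; rewrite /oriented_cycle /= => /eqP -> xy xyD yxD.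
apply/existsP; exists [ffun i : 'I_2 => if val i == 0 then x else y]; apply/andP; split.
  apply/injectiveP => -[[|[|//]] i] [[|[|//]] j]; rewrite !ffunE //= => E; try exact: val_inj.
    by rewrite E eqxx in xy.
  by rewrite E eqxx in xy.
by apply/forall_inP => -[[[|[|//]] i] [[|[|//]] j]]; rewrite !inE !ffunE.
Qed.

Lemma min_semidegree_le (T : finType) (D : {set T * T}) x :
  min_semidegree D <= minn (outdegree D x) (indegree D x).
Proof.
rewrite /min_semidegree; have : x \in index_enum T by exact: mem_index_enum.
elim: (index_enum T) => // y s IH; rewrite inE big_cons geq_min.
by case/predU1P => [->|/IH ->]; rewrite ?leqnn ?orbT.
Qed.

Lemma card_sum_outdegree (T : finType) (D : {set T * T}) :
  #|D| = \sum_x outdegree D x.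
Proof.
rewrite -sum1_card (eq_bigl (fun p => xpredT p.1 && ((p.1, p.2) \in D))); last by case.
rewrite -(pair_big_dep xpredT (fun x y => (x, y) \in D) (fun _ _ => 1)) /=.
by apply: eq_bigr => x _; rewrite /outdegree -sum1_card; apply: eq_bigl => y; rewrite inE.
Qed.

Lemma exists_log_threshold B : exists E, forall e, E <= e -> 6 * (B * e) < 2 ^ e.
Proof.
exists (24 * B) => e he; pose k := e %/ 2.
have h1 := ltn_expl k (leqnn 2).
have h2 : e = k * 2 + e %% 2 by exact: divn_eq.
have h3 : e %% 2 < 2 by rewrite ltn_pmod.
have h4 : 2 ^ k * 2 ^ k <= 2 ^ e by rewrite -expnD leq_exp2l //; clear -h2; lia.
apply: leq_trans h4; apply: leq_trans (leq_mul h1 h1).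
by clear - he h2 h3; nia.
Qed.

Local Open Scope ring_scope.

Section RandomDigraph.
Variables (R : realType) (n : nat) (p : R).
Implicit Types (E Q : {set 'I_n * 'I_n}).

Let weight E : R := \prod_(e : 'I_n * 'I_n | e.1 != e.2) (if e \in E then p else 1 - p).

(** Expanding the product of [F e + G e] gives a sum over all edge sets E. As F vanishes on loops
    and on Q, only the loopless E avoiding Q survive. The factor is 1 - p on Q and 1 elsewhere. *)
Lemma prob_avoid Q : (forall e, e \in Q -> e.1 != e.2) ->
  \sum_(E | loopless E && [disjoint Q & E]) weight E = (1 - p) ^+ #|Q|.
Proof.
move=> Qoff.
pose F (e : 'I_n * 'I_n) : R := if (e.1 != e.2) && (e \notin Q) then p else 0.
pose G (e : 'I_n * 'I_n) : R := if e.1 != e.2 then 1 - p else 1.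
have -> : (1 - p) ^+ #|Q| = \prod_e (F e + G e).
  rewrite -prodr_const [RHS](bigID (mem Q)) /= [X in _ * X]big1 ?mulr1.
    by apply: eq_bigr => e eQ; rewrite /F /G eQ andbF Qoff // add0r.
  by move=> e eQ; rewrite /F /G eQ andbT; case: eqP => _ /=; ring.
rewrite bigA_distr [RHS](bigID (fun E => loopless E && [disjoint Q & E])) /=.
rewrite [X in _ + X]big1 ?addr0.
  apply: eq_big => [E|E /andP [/forallP lE dE]] //.
  rewrite /weight big_mkcond /=; apply: eq_bigr => -[x y] _; rewrite /F /G /=.
  have [<-|xy] /= := eqVneq x y; first by rewrite (negbTE (lE x)).
  case: ifP => // eE; have -> //: (x, y) \notin Q.
  by apply/negP => eQ; move: dE; rewrite disjoint_subset => /subsetP /(_ _ eQ); rewrite inE eE.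
move=> E; rewrite negb_and => /orP [|].
  rewrite negb_forall => /existsP [x]; rewrite negbK => xE.
  by rewrite (bigD1 (x, x)) //= xE /F /= eqxx mul0r.
rewrite -setI_eq0 => /set0Pn [e]; rewrite inE => /andP [eQ eE].
by rewrite (bigD1 e) //= eE /F eQ andbF mul0r.
Qed.

(** Union bound: if A fails, E misses some [Q i], and each is missed with probability at most (1 -
    p)^N. *)
Lemma prob_hitting (I : finType) (P : pred I) (Q : I -> {set 'I_n * 'I_n}) (N : nat)
    (A : pred {set 'I_n * 'I_n}) :
  0 <= p <= 1 ->
  (forall i, P i -> (forall e, e \in Q i -> e.1 != e.2) /\ (N <= #|Q i|)%N) ->
  (forall E, loopless E -> (forall i, P i -> ~~ [disjoint Q i & E]) -> A E) ->
  1 - #|I|%:R * (1 - p) ^+ N <= random_digraph_prob p A.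
Proof.
case/andP => p0 p1 HQ HA.
have w0 E : 0 <= weight E.
  by apply: prodr_ge0 => e _; case: ifP => // _; rewrite subr_ge0.
have tot : \sum_(E | loopless E) weight E = 1.
  have := @prob_avoid set0; rewrite cards0 expr0 => <-; last by move=> e; rewrite inE.
  by apply: eq_bigl => E; rewrite -setI_eq0 set0I eqxx andbT.
have q0 : 0 <= 1 - p by rewrite subr_ge0.
rewrite lerBlDr -[X in X <= _]tot (bigID A) /= /random_digraph_prob lerD2l.
apply: (@le_trans _ _ (\sum_(E | loopless E && ~~ A E)
    \sum_(i | P i && [disjoint Q i & E]) weight E)).
  apply: ler_sum => E /andP [lE nA].
  have [i /andP [Pi di]|no] := pickP (fun i => P i && [disjoint Q i & E]).
    by rewrite (bigD1 i) /= ?Pi // lerDl sumr_ge0.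
  case/negP: nA; apply: HA => // i Pi; apply/negP => di.
  by have := no i; rewrite /= Pi di.
rewrite (exchange_big_dep P) /=; last by move=> E i _ /andP [].
apply: (@le_trans _ _ (\sum_(i | P i) (1 - p) ^+ N)).
  apply: ler_sum => i Pi; have [Qoff QN] := HQ i Pi.
  apply: (@le_trans _ _ (\sum_(E | loopless E && [disjoint Q i & E]) weight E)).
    rewrite big_mkcond [X in _ <= X]big_mkcond /=; apply: ler_sum => E _.
    by rewrite Pi /=; case: (loopless E); case: (A E); case: [disjoint _ & _] => /=.
  by rewrite prob_avoid // ler_wiXn2l // lerBlDr lerDl.
rewrite sumr_const -[X in X <= _]mulr_natl ler_wpM2r ?exprn_ge0 //.
by rewrite ler_nat max_card.
Qed.

End RandomDigraph.

(** * Estimates and conclusion *)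

Lemma bernoulli_ineq (R : realType) (x : R) (k : nat) : 0 <= x -> 1 + k%:R * x <= (1 + x) ^+ k.
Proof.
move=> x0; elim: k => [|k IH]; first by rewrite mul0r addr0 expr0.
rewrite exprS; apply: le_trans (_ : (1 + x) * (1 + k%:R * x) <= _).
  have : 0 <= k%:R * x * x by rewrite !mulr_ge0.
  rewrite -natr1; nra.
by rewrite ler_wpM2l // addr_ge0.
Qed.

(** Since (1 - p)(1 + p) <= 1, it suffices that (1 + p)^(e^2) >= 8^n. By Bernoulli (1 + p)^e >= ep
    >= 8^(2B), and the e-th power of this is at least 8^n. The base 8 is 4 for the pairs of sets
    times 2 for the decay. *)
Lemma one_sub_expn_le (R : realType) (B e n : nat) :
  (0 < n)%N -> (n <= 2 * B * e)%N -> (2 * B * 8 ^ (2 * B) <= n)%N ->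
  (1 - (2 * B * 8 ^ (2 * B))%:R / n%:R) ^+ (e * e) * 8 ^+ n <= 1 :> R.
Proof.
move=> n0 ne Cn; set C := (2 * B * 8 ^ (2 * B))%N in Cn *; set p : R := C%:R / n%:R.
have nR : 0 < n%:R :> R by rewrite ltr0n.
have p0 : 0 <= p by rewrite divr_ge0.
have p1 : p <= 1 by rewrite ler_pdivrMr // mul1r ler_nat.
have h : (8 : R) ^+ n <= (1 + p) ^+ (e * e).
  have h1 : (8 : R) ^+ (2 * B) <= (1 + p) ^+ e.
    apply: le_trans (bernoulli_ineq e p0).
    have : (8 : R) ^+ (2 * B) <= e%:R * p; last by lra.
    rewrite /p mulrA ler_pdivlMr // -natrX -!natrM ler_nat /C.
    by apply: leq_trans (leq_mul (leqnn _) ne) _; rewrite mulnC; clear; nia.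
  rewrite exprM; apply: le_trans (_ : (8 ^+ (2 * B)) ^+ e <= _); last first.
    by rewrite lerXn2r // nnegrE ?exprn_ge0 // addr_ge0.
  by rewrite -exprM ler_eXn2l // ltr1n.
apply: le_trans (_ : (1 - p) ^+ (e * e) * (1 + p) ^+ (e * e) <= _).
  by rewrite ler_wpM2l // exprn_ge0 // subr_ge0.
rewrite -exprMn exprn_ile1 //; nra.
Qed.

Theorem theorem1p3 (R : realType) (alpha : R) (alpha_gt0 : 0 < alpha) :
  exists C : R, 0 < C /\
    forall eps : R, 0 < eps ->
    exists N : nat, forall n : nat, (N <= n)%N ->
    forall D0 : {set 'I_n * 'I_n}, loopless D0 ->
      alpha * n%:R <= (min_semidegree D0)%:R ->
      1 - eps <= random_digraph_prob (C / n%:R)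
                   (fun E => contains_all_oriented_cycles (D0 :|: E)).
Proof.
pose a := Num.bound alpha^-1.
have aP : 1 <= a%:R * alpha.
  have := archi_boundP (ltW (_ : 0 < alpha^-1)); rewrite invr_gt0 => /(_ alpha_gt0).
  by rewrite -/a => /ltW; rewrite -div1r ler_pdivrMr.
have a0 : (0 < a)%N by rewrite lt0n; apply: contraTneq aP => ->; rewrite mul0r -ltNge ltr01.
have [B [B0 aB HB]] := joined_digraph_cycles a0.
pose C := (2 * B * 8 ^ (2 * B))%N.
have C0 : (0 < C)%N by rewrite /C !muln_gt0 B0 expn_gt0.
exists C%:R; split; first by rewrite ltr0n.
move=> eps eps0.
have [E0 HE0] := exists_log_threshold B.
pose N2 := Num.bound (2 / eps).
(* The summands make e at least [E0], make C/n at most 1, and bring the error 2/2^n below eps. *)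
exists (B * (E0 + 2) + C + N2)%N => n nN D0 lD0 degD0.
pose e := (n %/ B)%N.
have eE0 : (E0 <= e)%N by rewrite leq_divRL //; move: nN; clear; nia.
have e0 : (0 < e)%N by rewrite divn_gt0 //; move: nN; clear; nia.
have n0 : (0 < n)%N by move: nN C0; clear; lia.
have Be : (B * e <= n)%N by rewrite mulnC leq_trunc_div.
have Be2 : (n <= 2 * (B * e))%N.
  have := ltn_ceil n B0; rewrite -/e; move: e0; clear; nia.
have nC : (C <= n)%N by move: nN; clear; lia.
have nR : 0 < n%:R :> R by rewrite ltr0n.
have semi x : (n <= a * minn (outdegree D0 x) (indegree D0 x))%N.
  rewrite -(ler_nat R) natrM.
  apply: (@le_trans _ _ (a%:R * (min_semidegree D0)%:R)); last first.
    by rewrite ler_wpM2l // ler_nat min_semidegree_le.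
  apply: le_trans (_ : a%:R * (alpha * n%:R) <= _); last by rewrite ler_wpM2l.
  by rewrite mulrA ler_peMl.
(* D0 has at least ne >= e^2 edges, so the event for 2-cycles obeys the same bound as the pairs of
   sets. *)
have ediag : (e * e <= #|D0|)%N.
  rewrite card_sum_outdegree; apply: (@leq_trans (\sum_(x < n) e)); last first.
    apply: leq_sum => x _; rewrite -(leq_pmul2l a0).
    apply: leq_trans (leq_trans (_ : (a * e <= B * e)%N) Be) _; first by rewrite leq_mul2r aB orbT.
    by apply: leq_trans (semi x) _; rewrite leq_mul2l geq_minl orbT.
  rewrite sum_nat_const card_ord leq_mul2r; apply/orP; right.
  by apply: leq_trans Be; rewrite leq_pmull.
(* [Some (A, B)] asks for a random edge from A to B, and [None] for a random edge reversing an edge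
   of D0. *)
pose I : finType := option ({set 'I_n} * {set 'I_n})%type.
pose P (i : I) := if i is Some AB then
  [&& [disjoint AB.1 & AB.2], (e <= #|AB.1|)%N & (e <= #|AB.2|)%N] else true.
pose Q (i : I) : {set 'I_n * 'I_n} :=
  if i is Some AB then setX AB.1 AB.2 else [set f | (f.2, f.1) \in D0].
have loopD0 x y : (x, y) \in D0 -> x != y.
  by move=> xy; apply: contraTneq xy => ->; exact: (forallP lD0).
have := @prob_hitting R n (C%:R / n%:R) I P Q (e * e)
  (fun E => contains_all_oriented_cycles (D0 :|: E)).
have p01 : 0 <= (C%:R : R) / n%:R <= 1.
  by rewrite divr_ge0 //= ler_pdivrMr // mul1r ler_nat.
move=> /(_ p01) H; apply: le_trans (H _ _).
- rewrite lerD2l lerN2.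
  have h1 := @one_sub_expn_le R B e n n0 _ nC; rewrite -/C in h1.
  have {}h1 := h1 (leq_trans Be2 (eq_leq (mulnA _ _ _))).
  have cI : (#|I| <= 2 * 4 ^ n)%N.
    rewrite card_option card_prod -!cardsT -!powersetT !card_powerset cardsT card_ord.
    have : (0 < 4 ^ n)%N by rewrite expn_gt0.
    by rewrite -expnMn (_ : (2 * 2 = 4)%N) //; clear; lia.
  have cIR : #|I|%:R <= 2 * 4 ^+ n :> R by rewrite -natrX -natrM ler_nat.
  set x := (1 - _) ^+ _ in h1 *.
  have x0 : 0 <= x by rewrite exprn_ge0 // subr_ge0; case/andP: p01.
  apply: (@le_trans _ _ (2 * 4 ^+ n * x)); first by rewrite ler_wpM2r.
  have e8 : (8 : R) ^+ n = 2 ^+ n * 4 ^+ n by rewrite -exprMn -natrM.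
  have t0 : (0 : R) < 2 ^+ n by rewrite exprn_gt0.
  rewrite -(ler_pM2l t0).
  apply: (@le_trans _ _ 2).
    by move: h1; rewrite e8; nra.
  have : 2 / eps < N2%:R by apply: archi_boundP; rewrite divr_ge0 // ltW.
  rewrite ltr_pdivrMr // => /ltW h2; apply: le_trans h2 _; rewrite ler_wpM2r ?ltW //.
  rewrite -natrX ltr_nat; apply: leq_ltn_trans (ltn_expl n (leqnn 2)).
  by move: nN; clear; lia.
- case=> [[A A']|] /=.
    case/and3P => dA cA cA'; split; last by rewrite cardsX leq_mul.
    move=> [x y]; rewrite !inE /= => /andP [xA yA]; apply: contraTneq yA => <-.
    by apply/negP => xA'; move: dA; rewrite disjoint_subset => /subsetP /(_ x xA); rewrite inE xA'.
  move=> _; split=> [[x y]|]; first by rewrite inE /= => /loopD0; rewrite eq_sym.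
  apply: leq_trans ediag _.
  have inj : injective (fun f : 'I_n * 'I_n => (f.2, f.1)) by move=> [? ?] [? ?] [-> ->].
  rewrite -(card_imset _ inj); apply: subset_leq_card; apply/subsetP => _ /imsetP [[x y] xyD ->].
  by rewrite inE.
move=> E lE hit; apply/forallP => l; apply/implyP => l2; apply/forallP => Hc; apply/implyP => oH.
have [l2E|lN2] := eqVneq (l : nat) 2.
  have := hit None isT; rewrite -setI_eq0 => /set0Pn [[y x]]; rewrite !inE /= => /andP [xyD yxE].
  by apply: (contains_two_cycle l2E oH (loopD0 _ _ xyD)); rewrite inE ?xyD // yxE orbT.
have l3 : (3 <= l)%N by rewrite ltn_neqAle eq_sym lN2.
have ln : (l <= n)%N by rewrite -ltnS.
have Jn : joined (D0 :|: E) e.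
  move=> A A' dA cA cA'; have := hit (Some (A, A')); rewrite /P /= dA cA cA' => /(_ isT).
  rewrite -setI_eq0 => /set0Pn [[x y]]; rewrite !inE /= => /andP [/andP [xA yA] xyE].
  by exists x, y; rewrite inE xyE orbT.
have cn : #|'I_n| = n by exact: card_ord.
have nb c v : (n <= a * #|nbr (D0 :|: E) c v|)%N.
  apply: leq_trans (semi v) _; rewrite leq_mul2l; apply/orP; right.
  case: c; [apply: leq_trans (geq_minl _ _) _ | apply: leq_trans (geq_minr _ _) _].
    by apply: subset_leq_card; apply/subsetP => y; rewrite inE => vy; rewrite inE /adj inE vy.
  by apply: subset_leq_card; apply/subsetP => y; rewrite inE => vy; rewrite inE /adj inE vy.
have hB := HB 'I_n (D0 :|: E) e e0; rewrite cn in hB.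
have [x [t [t1 t2 t3]]] := hB Be Be2 (HE0 e eE0) Jn nb
  (fun i => [exists k : 'I_l, (k == i :> nat) && ((k, ordS k) \in Hc)]) l l3 ln.
exact: (contains_walk l3 oH t1 t2 t3).
Qed.
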